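(* A sequence $(P_n)_{n\geq 1}$ of probability measures on $\big(\mathbb{D}([0,1];\mathbb{D}),\mathcal{D}_{\mathbb{D}}\big)$ is tight if and only if it satisfies the following three conditions: (i') there is a dense subset $T$ of $[0,1]$ containing $1$ such that for each $t\in T$, $\displaystyle\lim_{a \to \infty} \limsup_{n\to \infty} P_n\big(\{x:\ \|x(t)\|\geq a\}\big)=0$; (ii) for any $\varepsilon>0$, $\displaystyle\lim_{\delta \to 0}\limsup_{n\to \infty}P_n\big(\{x:\ w'(x(t),\delta) \geq \varepsilon \text{ for some } t \in [0,1]\}\big)=0$; (iii) for any $\varepsilon>0$, $\displaystyle\lim_{\delta \to 0}\limsup_{n\to \infty}P_n\big(\{x:\ w_{\mathbb{D}}'(x,\delta) \geq \varepsilon \}\big)=0$.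
   Context: $\mathbb{D}$ is the set of functions $x:[0,1]\to\mathbb{R}$ that are right-continuous and have left limits, with $\|x\|=\sup_{s\in[0,1]}|x(s)|$. $\Lambda$ is the set of strictly increasing continuous functions from $[0,1]$ onto $[0,1]$, $e$ is the identity on $[0,1]$, and for $\lambda\in\Lambda$, $\|\lambda\|^0=\sup_{s<s'}\left|\log\frac{\lambda(s')-\lambda(s)}{s'-s}\right|$. The Skorohod $J_1$-topology on $\mathbb{D}$ is given by the (complete, separable) metric $d_{J_1}^0(x,y)=\inf_{\lambda\in\Lambda}\{\|\lambda\|^0\vee\|x-y\circ\lambda\|\}$. $\mathbb{D}([0,1];\mathbb{D})$ is the set of functions $x:[0,1]\to\mathbb{D}$ that are right-continuous at every $t\in[0,1)$ and have a left limit $x(t-)\in\mathbb{D}$ at every $t\in(0,1]$, both with respect to $d_{J_1}^0$. It is equipped with the metric $d_{\mathbb{D}}(x,y)=\inf_{\lambda\in\Lambda}\{\|\lambda-e\|\vee\rho_{\mathbb{D}}(x,y\circ\lambda)\}$, where $\rho_{\mathbb{D}}(x,y)=\sup_{t\in[0,1]}d_{J_1}^0(x(t),y(t))$, and with its Borel $\sigma$-field $\mathcal{D}_{\mathbb{D}}$ for $d_{\mathbb{D}}$. A set $\{t_i\}_{0\le i\le v}$ with $0=t_0<t_1<\dots<t_v=1$ is $\delta$-sparse if $\min_{1\le i\le v}(t_i-t_{i-1})>\delta$. For $\delta\in(0,1)$: for $x\in\mathbb{D}$, $w'(x,\delta)=\inf_{\{t_i\}}\max_{1\le i\le v}\ \sup_{s_1,s_2\in[t_{i-1},t_i)}|x(s_1)-x(s_2)|$;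 for $x\in\mathbb{D}([0,1];\mathbb{D})$, $w'_{\mathbb{D}}(x,\delta)=\inf_{\{t_i\}}\max_{1\le i\le v}\ \sup_{r_1,r_2\in[t_{i-1},t_i)}d_{J_1}^0(x(r_1),x(r_2))$; both infima being over all $\delta$-sparse sets. A family of probability measures on $(\mathbb{D}([0,1];\mathbb{D}),\mathcal{D}_{\mathbb{D}})$ is tight if for every $\eta>0$ there is a $d_{\mathbb{D}}$-compact set $K$ with $P(K)\ge 1-\eta$ for every $P$ in the family. *)

(* Defs.v *)
From HB Require Import structures.
From mathcomp Require Import all_boot all_order all_algebra.
From mathcomp Require Import all_classical all_reals all_analysis.
From mathcomp Require Import lra.

Set Implicit Arguments.
Unset Strict Implicit.
Unset Printing Implicit Defensive.

Import Order.TTheory GRing.Theory Num.Theory.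
Import numFieldNormedType.Exports.

Local Open Scope classical_set_scope.
Local Open Scope ring_scope.

Notation I01 R := (set_type (`[0%R, 1%R]%classic : set R)).

Definition ival (R : realType) (t : I01 R) : R := \val t.

Section unit_interval.
Context {R : realType}.
Implicit Types s t : I01 R.

Lemma ival_inj : injective (@ival R).
Proof. exact: val_inj. Qed.

Lemma I01_ge0 t : 0 <= ival t.
Proof. by have /set_mem := valP t; rewrite /= in_itv/= => /andP[]. Qed.

Lemma I01_le1 t : ival t <= 1.
Proof. by have /set_mem := valP t; rewrite /= in_itv/= => /andP[]. Qed.

Lemma I01_proof (r : R) : 0 <= r <= 1 -> r \in `[0%R, 1%R]%classic.
Proof. by move=> r01; apply/mem_set; rewrite /= in_itv. Qed.

Definition mkI01 (r : R) (r01 : 0 <= r <= 1) : I01 R :=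
  exist _ r (I01_proof r01).

Lemma ival_mk (r : R) (r01 : 0 <= r <= 1) : ival (mkI01 r01) = r.
Proof. by []. Qed.

Definition I01_0 : I01 R.
Proof. by apply: (@mkI01 0); rewrite lexx ler01. Defined.

Definition I01_1 : I01 R.
Proof. by apply: (@mkI01 1); rewrite lexx ler01. Defined.

Lemma ival0 : ival I01_0 = 0. Proof. by []. Qed.

Lemma ival1 : ival I01_1 = 1. Proof. by []. Qed.

Lemma I01_nbhsP t (A : set (I01 R)) :
  nbhs t A <-> exists2 e : R, 0 < e & forall s, `|ival t - ival s| < e -> A s.
Proof.
split=> [/nbhs_ballP[e e0 H]|[e e0 H]]; first by exists e => // s se; apply: H.
by apply/nbhs_ballP; exists e => // s; apply: H.
Qed.

End unit_interval.

(* Right-continuity is required at every t in [0,1[, a left limit at every t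
   in ]0,1]; the filters are those of the topology of [0,1]. *)
Definition is_cadlag (R : realType) (S : topologicalType) (x : I01 R -> S) :=
  (forall t : I01 R, ival t < 1 ->
     x s @[s --> within [set s : I01 R | ival t <= ival s] (nbhs t)] --> x t) /\
  (forall t : I01 R, 0 < ival t ->
     exists l : S,
       x s @[s --> within [set s : I01 R | ival s < ival t] (nbhs t)] --> l).

Record cadlag (R : realType) (S : topologicalType) := Cadlag {
  cadlag_fun :> I01 R -> S ;
  cadlagP : is_cadlag cadlag_fun }.

Section cadlag_basics.
Context {R : realType}.

Lemma cadlag_ext (S : topologicalType) (x y : cadlag R S) : x =1 y -> x = y.
Proof.
case: x y => [x hx] [y hy] /= /funext xy; move: hx hy; rewrite xy => hx hy.
by congr Cadlag; exact: Prop_irrelevance.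
Qed.

Lemma cst_is_cadlag (S : topologicalType) (a : S) :
  is_cadlag (fun _ : I01 R => a).
Proof. by split=> [t _|t _]; [|exists a]; exact: cvg_cst. Qed.

Definition cst_cadlag (S : topologicalType) (a : S) : cadlag R S :=
  Cadlag (cst_is_cadlag a).

End cadlag_basics.

Section time_changes.
Context {R : realType}.

Definition Lambda : set (I01 R -> I01 R) :=
  [set lam : I01 R -> I01 R |
    [/\ forall s t : I01 R, ival s < ival t -> ival (lam s) < ival (lam t),
        continuous lam &
        forall u, exists s, lam s = u]].

(* These suprema are taken in \bar R: log_norm lam may be +oo. *)
Definition sup_norm (f : I01 R -> R) : \bar R :=
  ereal_sup [set `|f s|%:E | s in [set: I01 R]].

Definition log_norm (lam : I01 R -> I01 R) : \bar R :=
  ereal_sup [set `|ln ((ival (lam p.2) - ival (lam p.1)) /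
                       (ival p.2 - ival p.1))|%:E
            | p in [set p : I01 R * I01 R | ival p.1 < ival p.2]].

Implicit Types lam mu : I01 R -> I01 R.

Lemma Lambda_id : Lambda id.
Proof. by split=> // [t|u]; [exact: cvg_id|exists u]. Qed.

Lemma Lambda_lt lam : Lambda lam ->
  forall s t : I01 R, (ival (lam s) < ival (lam t)) = (ival s < ival t).
Proof.
move=> [lamlt _ _] s t; apply/idP/idP; last exact: lamlt.
apply: contraTT; rewrite -!leNgt le_eqVlt => /orP[/eqP/ival_inj -> //|/lamlt/ltW//].
Qed.

Lemma Lambda_comp lam mu : Lambda lam -> Lambda mu -> Lambda (mu \o lam).
Proof.
move=> [l1 l2 l3] [m1 m2 m3]; split.
- by move=> s t st; apply/m1/l1.
- by move=> t; apply: continuous_comp; [exact: l2|exact: m2].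
- by move=> u; have [v <-] := m3 u; have [w <-] := l3 v; exists w.
Qed.

Lemma Lambda0 lam : Lambda lam -> lam I01_0 = I01_0.
Proof.
move=> L; have [_ _ /(_ I01_0)[s ls]] := L.
suff s0 : s = I01_0 by rewrite -{1}s0.
by apply/ival_inj/eqP; rewrite eq_le leNgt -(Lambda_lt L) ls -leNgt I01_ge0/= I01_ge0.
Qed.

Lemma Lambda1 lam : Lambda lam -> lam I01_1 = I01_1.
Proof.
move=> L; have [_ _ /(_ I01_1)[s ls]] := L.
suff s1 : s = I01_1 by rewrite -{1}s1.
by apply/ival_inj/eqP; rewrite eq_le I01_le1 andTb leNgt -(Lambda_lt L) ls -leNgt I01_le1.
Qed.

Lemma increasing_onto_continuous lam :
  (forall s t : I01 R, (ival (lam s) < ival (lam t)) = (ival s < ival t)) ->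
  (forall u, exists s, lam s = u) -> continuous lam.
Proof.
move=> lt on t A /I01_nbhsP[e e0 eA]; apply/I01_nbhsP.
have [d1 d10 H1] : exists2 d : R, 0 < d & forall s, ival t - d < ival s ->
    ival (lam t) - e < ival (lam s).
  have [te|te] := ltP (ival (lam t) - e) 0.
    by exists 1 => // s _; exact: lt_le_trans te (I01_ge0 _).
  have te1 : 0 <= ival (lam t) - e <= 1.
    by rewrite te/= (le_trans _ (I01_le1 (lam t)))// gerBl ltW.
  have [u lu] := on (mkI01 te1).
  have ut : ival u < ival t by rewrite -lt lu ival_mk gtrBl.
  exists (ival t - ival u); first by rewrite subr_gt0.
  move=> s; rewrite opprB addrC subrK -lt lu ival_mk; exact.
have [d2 d20 H2] : exists2 d : R, 0 < d & forall s, ival s < ival t + d ->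
    ival (lam s) < ival (lam t) + e.
  have [te|te] := ltP 1 (ival (lam t) + e).
    by exists 1 => // s _; exact: le_lt_trans (I01_le1 _) te.
  have te1 : 0 <= ival (lam t) + e <= 1.
    by rewrite te/= andbT addr_ge0// ?I01_ge0// ltW.
  have [u lu] := on (mkI01 te1).
  have ut : ival t < ival u by rewrite -lt lu ival_mk ltrDl.
  exists (ival u - ival t); first by rewrite subr_gt0.
  move=> s; rewrite addrC subrK -lt lu ival_mk; exact.
exists (Num.min d1 d2); first by rewrite lt_min d10.
move=> s; rewrite lt_min !ltr_norml => /andP[/andP[a b] /andP[c d]].
apply: eA; rewrite ltr_norml.
have := H1 s; have := H2 s; lra.
Qed.

Lemma Lambda_inv lam : Lambda lam ->
  exists mu, [/\ Lambda mu, cancel lam mu & cancel mu lam].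
Proof.
move=> L; have [_ _ on] := L.
have [mu muP] := choice on.
have K : cancel lam mu.
  move=> t; apply/ival_inj/eqP; rewrite eq_le; apply/andP.
  by split; rewrite leNgt -(Lambda_lt L) muP ltxx.
exists mu; split => //.
have mlt s t : (ival (mu s) < ival (mu t)) = (ival s < ival t).
  by rewrite -(Lambda_lt L (mu s) (mu t)) !muP.
have mon u : exists s, mu s = u by exists (lam u).
by split => //; [move=> s t; rewrite mlt|exact: increasing_onto_continuous].
Qed.

End time_changes.
Arguments Lambda R : clear implicits.

(* Metric axioms for inf_lam max (N lam) (sup_t d (x t) (y (lam t))), which is
   the shape of both Skorohod metrics used below. *)
Section skorohod_metric.
Context {R : realType} {S : pseudoMetricType R}.
Variables (d : S -> S -> R) (N : (I01 R -> I01 R) -> \bar R).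
Hypothesis ballE : forall x e y, ball x e y <-> d x y < e.
Hypothesis dxx : forall x, d x x = 0.
Hypothesis d_eq : forall x y, d x y = 0 -> x = y.
Hypothesis dC : forall x y, d x y = d y x.
Hypothesis dT : forall y x z, d x z <= d x y + d y z.
Hypothesis N_id : (N id <= 0)%E.
Hypothesis N_ge0 : forall lam, (0 <= N lam)%E.
Hypothesis N_inv : forall lam mu, Lambda R lam -> Lambda R mu ->
  cancel lam mu -> cancel mu lam -> (N mu <= N lam)%E.
Hypothesis N_comp : forall lam mu, Lambda R lam -> Lambda R mu ->
  (N (mu \o lam) <= N lam + N mu)%E.
Hypothesis N_small : forall e : R, 0 < e -> exists2 n : R, 0 < n &
  forall lam, Lambda R lam -> (N lam < n%:E)%E ->
  forall t, `|ival (lam t) - ival t| < e.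

Implicit Types x y z : cadlag R S.

Definition sko x y : \bar R :=
  ereal_inf [set maxe (N lam)
                   (ereal_sup [set (d (x t) (y (lam t)))%:E | t in [set: I01 R]])
            | lam in Lambda R].

Let d_ge0 a b : 0 <= d a b.
Proof. by have := dT b a a; rewrite dxx (dC b a); lra. Qed.

Lemma cadlag_right x t e : ival t < 1 -> 0 < e -> exists2 del : R, 0 < del &
  forall s, ival t <= ival s < ival t + del -> d (x t) (x s) < e.
Proof.
move=> t1 e0; have [/(_ t t1) + _] := cadlagP x.
move=> /(_ (ball (x t) e) (nbhsx_ballx _ _ e0)).
rewrite /nbhs/= /within/= => /I01_nbhsP[del del0 H].
exists del => // s /andP[ts sd]; apply/ballE/H => //.
by rewrite ltr_norml; lra.
Qed.

Lemma cadlag_left x t : 0 < ival t -> exists l, forall e, 0 < e ->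
  exists2 del : R, 0 < del &
  forall s, ival t - del < ival s < ival t -> d l (x s) < e.
Proof.
move=> t0; have [_ /(_ t t0)[l xl]] := cadlagP x; exists l => e e0.
have := xl (ball l e) (nbhsx_ballx _ _ e0).
rewrite /nbhs/= /within/= => /I01_nbhsP[del del0 H].
exists del => // s /andP[ts sd]; apply/ballE/H => //.
by rewrite ltr_norml; lra.
Qed.

Lemma cadlag_locally_bounded x t : exists del M : R, 0 < del /\
  forall s, `|ival t - ival s| < del -> d (x I01_0) (x s) <= M.
Proof.
have [del1 [M1 [del10 H1]]] : exists del M : R, 0 < del /\
    forall s, ival t - del < ival s < ival t -> d (x I01_0) (x s) <= M.
  have [t0|t0] := leP (ival t) 0.
    by exists 1, 0; split => // s; have := I01_ge0 s; lra.
  have [l /(_ _ ltr01)[del del0 H]] := cadlag_left x t0.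
  exists del, (d (x I01_0) l + 1); split => // s /H.
  by have := dT l (x I01_0) (x s); lra.
have [del2 [M2 [del20 H2]]] : exists del M : R, 0 < del /\
    forall s, ival t <= ival s < ival t + del -> d (x I01_0) (x s) <= M.
  have [t1|t1] := leP 1 (ival t).
    exists 1, (d (x I01_0) (x t)); split => // s ts.
    by rewrite (_ : s = t)//; apply/ival_inj; have := I01_le1 s; lra.
  have [del del0 H] := cadlag_right x t1 ltr01.
  exists del, (d (x I01_0) (x t) + 1); split => // s /H.
  by have := dT (x t) (x I01_0) (x s); lra.
exists (Num.min del1 del2), (Num.max M1 M2); split; first by rewrite lt_min del10.
move=> s; rewrite lt_min !ltr_norml le_max => h; apply/orP.
have [ts|ts] := leP (ival t) (ival s); [right; apply: H2|left; apply: H1]; lra.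
Qed.

Lemma cadlag_bounded x : exists M, forall s, d (x I01_0) (x s) <= M.
Proof.
have /compact_near_coveringP cov := @segment_compact R 0 1.
have := cov R (+oo%R) (fun M r => forall s : I01 R, ival s = r ->
  d (x I01_0) (x s) <= M) _.
case.
- move=> r; rewrite /= in_itv/= => r01.
  have [del [M [del0 H]]] := cadlag_locally_bounded x (mkI01 r01).
  exists (ball r del, [set M' | M < M']) => /=.
    by split; [exact: nbhsx_ballx|exists M; rewrite num_real].
  move=> [r' M']/= [rr' MM'] s sr'; apply: le_trans (ltW MM').
  by apply: H; rewrite ival_mk sr'.
- move=> M [_ H]; exists (M + 1) => s.
  by apply: (H (M + 1) _ (ival s)) => //=; rewrite ?ltrDl// in_itv/= I01_ge0 I01_le1.
Qed.

Lemma sko_ge0 x y : (0 <= sko x y)%E.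
Proof. by apply: le_ereal_inf_tmp => _ [lam _ <-]; rewrite le_max N_ge0. Qed.

Lemma sko_le x y (e : R) lam : Lambda R lam -> (N lam <= e%:E)%E ->
  (forall t, d (x t) (y (lam t)) <= e) -> (sko x y <= e%:E)%E.
Proof.
move=> L Ne H; apply: ge_ereal_inf; eexists; first by exists lam.
rewrite ge_max Ne/=; apply: ge_ereal_sup => _ [t _ <-].
by rewrite lee_fin.
Qed.

Lemma sko_lt x y (e : R) : (sko x y < e%:E)%E -> exists lam,
  [/\ Lambda R lam, (N lam < e%:E)%E & forall t, d (x t) (y (lam t)) < e].
Proof.
move=> /ereal_inf_lt[_ [lam L <-]]; rewrite gt_max => /andP[Ne He].
exists lam; split => // t; rewrite -lte_fin; apply: le_lt_trans He.
by apply: ereal_sup_ubound; exists t.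
Qed.

Lemma sko_fin x y : sko x y \is a fin_num.
Proof.
rewrite ge0_fin_numE ?sko_ge0//.
have [Mx Hx] := cadlag_bounded x; have [My Hy] := cadlag_bounded y.
pose M := Mx + (d (x I01_0) (y I01_0) + My).
have xyM t : d (x t) (y t) <= M.
  have := dT (x I01_0) (x t) (y t); have := dT (y I01_0) (x I01_0) (y t).
  by have := Hx t; have := Hy t; rewrite (dC (x t) (x I01_0)) /M; lra.
apply: (@le_lt_trans _ _ M%:E); last exact: ltry.
apply: (sko_le Lambda_id) => //; apply: (le_trans N_id).
by rewrite lee_fin (le_trans _ (xyM I01_0)).
Qed.

Let dist x y := fine (sko x y).

Let distE x y : sko x y = (dist x y)%:E.
Proof. by rewrite fineK ?sko_fin. Qed.

Let dist_lt x y (e : R) : dist x y < e -> exists lam,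
  [/\ Lambda R lam, (N lam < e%:E)%E & forall t, d (x t) (y (lam t)) < e].
Proof. by move=> h; apply: sko_lt; rewrite distE lte_fin. Qed.

Let dist_le x y (e : R) lam : Lambda R lam -> (N lam <= e%:E)%E ->
  (forall t, d (x t) (y (lam t)) <= e) -> dist x y <= e.
Proof. by move=> L Ne H; rewrite -lee_fin -distE; exact: sko_le H. Qed.

Lemma sko_refl x : fine (sko x x) = 0.
Proof.
apply/eqP; rewrite eq_le fine_ge0 ?sko_ge0// andbT.
by apply: (dist_le Lambda_id) => // t; rewrite dxx.
Qed.

Lemma sko_sym x y : fine (sko x y) = fine (sko y x).
Proof.
suff H u v : dist u v <= dist v u by apply/eqP; rewrite eq_le !H.
apply/ler_addgt0Pl => e e0; have /dist_lt[lam [L Ne He]] :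
  dist v u < e + dist v u by rewrite ltrDr.
have [mu [M lamK muK]] := Lambda_inv L.
apply: (dist_le M); first exact: le_trans (N_inv L M lamK muK) (ltW Ne).
by move=> t; rewrite dC -{2}(muK t) ltW.
Qed.

Lemma sko_triangle y x z :
  fine (sko x z) <= fine (sko x y) + fine (sko y z).
Proof.
apply/ler_addgt0Pl => e e0.
have e20 : 0 < e / 2 by rewrite divr_gt0.
have /dist_lt[lam [L Nl Hl]] : dist x y < e / 2 + dist x y by rewrite ltrDr.
have /dist_lt[mu [M Nm Hm]] : dist y z < e / 2 + dist y z by rewrite ltrDr.
have E : e + (fine (sko x y) + fine (sko y z)) =
    (e / 2 + dist x y) + (e / 2 + dist y z) by rewrite /dist; lra.
rewrite E; apply: (dist_le (Lambda_comp L M)).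
  by rewrite (le_trans (N_comp L M))// EFinD leeD// ltW.
move=> t; rewrite (le_trans (dT (y (lam t)) _ _))//.
by rewrite lerD// ltW.
Qed.

Lemma sko_eq x y : fine (sko x y) = 0 -> x = y.
Proof.
move=> xy0; apply: cadlag_ext => t; apply: d_eq; apply/eqP.
rewrite eq_le d_ge0 andbT; apply/ler_addgt0Pl => e e0; rewrite addr0.
have e30 : 0 < e / 3 by rewrite divr_gt0.
have [t1|t1] := leP 1 (ival t).
  have /dist_lt[lam [L _ H]] : dist x y < e by rewrite /dist xy0.
  have -> : t = I01_1.
    by apply/ival_inj; have := I01_le1 t; rewrite ival1; lra.
  by have := H I01_1; rewrite (Lambda1 L) => /ltW.
have [d1 d10 H1] := cadlag_right x t1 e30.
have [d2 d20 H2] := cadlag_right y t1 e30.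
pose del := Num.min (Num.min d1 d2) (1 - ival t).
have del0 : 0 < del by rewrite !lt_min d10 d20/= subr_gt0.
have [deld1 deld2 delt] : [/\ del <= d1, del <= d2 & del <= 1 - ival t].
  by split; rewrite /del !ge_min lexx ?orbT.
have s01 : 0 <= ival t + del / 2 <= 1.
  by have := I01_ge0 t; lra.
have [n n0 Hn] : exists2 n : R, 0 < n & forall lam, Lambda R lam ->
  (N lam < n%:E)%E -> forall t, `|ival (lam t) - ival t| < del / 2.
  by apply: N_small; rewrite divr_gt0.
have /dist_lt[lam [L Nl H]] : dist x y < Num.min n (e / 3).
  by rewrite /dist xy0 lt_min n0.
pose s := mkI01 s01.
have := H s; rewrite lt_min => /andP[_ xys].
have /(Hn _ L)/(_ s) : (N lam < n%:E)%E.
  by apply: (lt_le_trans Nl); rewrite lee_fin ge_min lexx.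
rewrite ltr_norml ival_mk => /andP[ls1 ls2].
have xs : d (x t) (x s) < e / 3 by apply: H1; rewrite ival_mk; lra.
have ys : d (y t) (y (lam s)) < e / 3.
  by apply: H2; lra.
have := dT (x s) (x t) (y t); have := dT (y (lam s)) (x s) (y t).
by rewrite (dC (y (lam s))); lra.
Qed.

End skorohod_metric.

Section time_change_norms.
Context {R : realType}.
Implicit Types lam mu : I01 R -> I01 R.

Lemma sup_norm_le (f : I01 R -> R) (a : \bar R) :
  (forall t, `|f t|%:E <= a)%E -> (sup_norm f <= a)%E.
Proof. by move=> H; apply: ge_ereal_sup => _ [t _ <-]. Qed.

Lemma le_sup_norm (f : I01 R -> R) t : (`|f t|%:E <= sup_norm f)%E.
Proof. by apply: ereal_sup_ubound; exists t. Qed.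

Lemma sup_norm_ge0 (f : I01 R -> R) : (0 <= sup_norm f)%E.
Proof. by apply: le_trans (le_sup_norm f I01_0); rewrite lee_fin. Qed.

Definition dev_norm lam : \bar R := sup_norm (fun t => ival (lam t) - ival t).

Lemma dev_norm_id : (dev_norm id <= 0)%E.
Proof. by apply: sup_norm_le => t; rewrite subrr normr0. Qed.

Lemma dev_norm_inv lam mu : Lambda R lam -> Lambda R mu ->
  cancel lam mu -> cancel mu lam -> (dev_norm mu <= dev_norm lam)%E.
Proof.
move=> _ _ _ muK; apply: sup_norm_le => t.
rewrite distrC -{1}(muK t).
exact: (le_sup_norm (fun t => ival (lam t) - ival t)).
Qed.

Lemma dev_norm_comp lam mu : Lambda R lam -> Lambda R mu ->
  (dev_norm (mu \o lam) <= dev_norm lam + dev_norm mu)%E.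
Proof.
move=> _ _; apply: sup_norm_le => t /=.
apply: (@le_trans _ _ (`|ival (lam t) - ival t|%:E +
                       `|ival (mu (lam t)) - ival (lam t)|%:E)%E).
  rewrite -EFinD lee_fin.
  have -> : ival (mu (lam t)) - ival t =
    (ival (lam t) - ival t) + (ival (mu (lam t)) - ival (lam t)) by lra.
  exact: ler_normD.
by apply: leeD; [exact: (le_sup_norm (fun t => ival (lam t) - ival t))|
  exact: (le_sup_norm (fun t => ival (mu t) - ival t))].
Qed.

Lemma dev_norm_small (e : R) : 0 < e -> exists2 n : R, 0 < n &
  forall lam, Lambda R lam -> (dev_norm lam < n%:E)%E ->
  forall t, `|ival (lam t) - ival t| < e.
Proof.
move=> e0; exists e => // lam _ le t; rewrite -lte_fin; apply: le_lt_trans le.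
exact: (le_sup_norm (fun t => ival (lam t) - ival t)).
Qed.

Lemma log_norm_le lam (a : \bar R) : (forall s t : I01 R, ival s < ival t ->
    (`|ln ((ival (lam t) - ival (lam s)) / (ival t - ival s))|%:E <= a)%E) ->
  (log_norm lam <= a)%E.
Proof. by move=> H; apply: ge_ereal_sup => _ [[s t] /= st <-]; exact: H. Qed.

Lemma le_log_norm lam (s t : I01 R) : ival s < ival t ->
  (`|ln ((ival (lam t) - ival (lam s)) / (ival t - ival s))|%:E
     <= log_norm lam)%E.
Proof. by move=> st; apply: ereal_sup_ubound; exists (s, t). Qed.

Lemma log_norm_ge0 lam : (0 <= log_norm lam)%E.
Proof.
have h01 : ival (I01_0 : I01 R) < ival (I01_1 : I01 R).
  by rewrite ival0 ival1.
by apply: le_trans (le_log_norm lam h01); rewrite lee_fin.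
Qed.

Lemma log_norm_id : (@log_norm R id <= 0)%E.
Proof.
apply: log_norm_le => s t st.
by rewrite divff ?ln1 ?normr0// subr_eq0 gt_eqF.
Qed.

Lemma log_norm_inv lam mu : Lambda R lam -> Lambda R mu ->
  cancel lam mu -> cancel mu lam -> (log_norm mu <= log_norm lam)%E.
Proof.
move=> L M _ muK; apply: log_norm_le => s t st.
have mst : ival (mu s) < ival (mu t) by rewrite (Lambda_lt M).
have := le_log_norm lam mst; rewrite !muK => /(le_trans _); apply.
rewrite lee_fin -[X in ln X]invf_div lnV ?normrN//.
by rewrite posrE divr_gt0// subr_gt0.
Qed.

Lemma log_norm_comp lam mu : Lambda R lam -> Lambda R mu ->
  (log_norm (mu \o lam) <= log_norm lam + log_norm mu)%E.
Proof.
move=> L M; apply: log_norm_le => s t st /=.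
have lst : ival (lam s) < ival (lam t) by rewrite (Lambda_lt L).
have mst : ival (mu (lam s)) < ival (mu (lam t)) by rewrite (Lambda_lt M).
apply: le_trans (leeD (le_log_norm lam st) (le_log_norm mu lst)).
rewrite -EFinD lee_fin (le_trans _ (ler_normD _ _))//.
rewrite -lnM ?posrE ?divr_gt0 ?subr_gt0// (mulrC (_ / _)) mulrA divfK//.
by rewrite subr_eq0 gt_eqF.
Qed.

Lemma log_norm_small (e : R) : 0 < e -> exists2 n : R, 0 < n &
  forall lam, Lambda R lam -> (log_norm lam < n%:E)%E ->
  forall t, `|ival (lam t) - ival t| < e.
Proof.
move=> e0; exists (ln (1 + e)); first by rewrite ln_gt0// ltrDl.
move=> lam L le t.
have [t0|t0] := leP (ival t) 0.
  have -> : t = I01_0 by apply/ival_inj; have := I01_ge0 t; rewrite ival0; lra.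
  by rewrite Lambda0// subrr normr0.
have lt0 : 0 < ival (lam t).
  by rewrite -ival0 -(Lambda0 L) (Lambda_lt L) ival0.
have st : ival (I01_0 : I01 R) < ival t by rewrite ival0.
have := le_lt_trans (le_log_norm lam st) le.
rewrite Lambda0// ival0 !subr0 lte_fin ltr_norml => /andP[].
have e1 : 0 < 1 + e by rewrite addr_gt0.
rewrite -lnV ?posrE// !ltr_ln ?posrE ?invr_gt0 ?divr_gt0//.
rewrite ltr_pdivlMr// ltr_pdivrMr// ltr_pdivrMl// => h1 h2.
have := I01_le1 t; have := I01_le1 (lam t).
by rewrite ltr_norml; nra.
Qed.

End time_change_norms.

(* The infima defining dJ1 and dDD are finite (lemma sko_fin, since cadlag
   functions are bounded), so that fine does not lose information. *)
Definition skoD (R : realType) : Type := cadlag R R.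

Section skoD_metric.
Context {R : realType}.
Implicit Types x y : skoD R.

Definition dJ1 x y : R :=
  fine (ereal_inf [set maxe (log_norm lam) (sup_norm (fun s => x s - y (lam s)))
                  | lam in Lambda R]).

Let dR (a b : R) : R := `|a - b|.

Let dR_ball (a e b : R) : ball a e b <-> dR a b < e. Proof. by []. Qed.

Let dR_refl a : dR a a = 0. Proof. by rewrite /dR subrr normr0. Qed.

Let dR_eq a b : dR a b = 0 -> a = b.
Proof. by move/normr0_eq0/eqP; rewrite subr_eq0 => /eqP. Qed.

Let dR_sym a b : dR a b = dR b a. Proof. exact: distrC. Qed.

Let dR_triangle b a c : dR a c <= dR a b + dR b c.
Proof. exact: ler_distD. Qed.

Lemma dJ1_refl x : dJ1 x x = 0.
Proof.
exact: (sko_refl dR_ball dR_refl dR_sym dR_triangle log_norm_id log_norm_ge0).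
Qed.

Lemma dJ1_eq x y : dJ1 x y = 0 -> x = y.
Proof.
exact: (sko_eq dR_ball dR_refl dR_eq dR_sym dR_triangle log_norm_id
  log_norm_ge0 log_norm_small).
Qed.

Lemma dJ1_sym x y : dJ1 x y = dJ1 y x.
Proof.
exact: (sko_sym dR_ball dR_refl dR_sym dR_triangle log_norm_id log_norm_ge0
  log_norm_inv).
Qed.

Lemma dJ1_triangle y x z : dJ1 x z <= dJ1 x y + dJ1 y z.
Proof.
exact: (sko_triangle dR_ball dR_refl dR_sym dR_triangle log_norm_id log_norm_ge0
  log_norm_comp).
Qed.

End skoD_metric.

HB.instance Definition _ (R : realType) := gen_eqMixin (skoD R).
HB.instance Definition _ (R : realType) := gen_choiceMixin (skoD R).
HB.instance Definition _ (R : realType) :=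
  isPointed.Build (skoD R) (cst_cadlag 0).
HB.instance Definition _ (R : realType) := isMetric.Build R (skoD R)
  (@dJ1_refl R) (@dJ1_eq R) (@dJ1_sym R) (@dJ1_triangle R).

(* Here cadlag refers to the topology of dJ1 on skoD R. *)
Definition skoDD (R : realType) : Type := cadlag R (skoD R).

Section skoDD_metric.
Context {R : realType}.
Implicit Types x y : skoDD R.

Definition rhoD (x y : I01 R -> skoD R) : \bar R :=
  ereal_sup [set (dJ1 (x t) (y t))%:E | t in [set: I01 R]].

Definition dDD x y : R :=
  fine (ereal_inf [set maxe (dev_norm lam) (rhoD x (y \o lam))
                  | lam in Lambda R]).

Let dJ1_ball (a : skoD R) (e : R) (b : skoD R) : ball a e b <-> dJ1 a b < e.
Proof. by rewrite ballEmdist. Qed.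

Lemma dDD_refl x : dDD x x = 0.
Proof.
exact: (sko_refl dJ1_ball dJ1_refl dJ1_sym dJ1_triangle dev_norm_id
  (fun=> sup_norm_ge0 _)).
Qed.

Lemma dDD_eq x y : dDD x y = 0 -> x = y.
Proof.
exact: (sko_eq dJ1_ball dJ1_refl dJ1_eq dJ1_sym dJ1_triangle dev_norm_id
  (fun=> sup_norm_ge0 _) dev_norm_small).
Qed.

Lemma dDD_sym x y : dDD x y = dDD y x.
Proof.
exact: (sko_sym dJ1_ball dJ1_refl dJ1_sym dJ1_triangle dev_norm_id
  (fun=> sup_norm_ge0 _) dev_norm_inv).
Qed.

Lemma dDD_triangle y x z : dDD x z <= dDD x y + dDD y z.
Proof.
exact: (sko_triangle dJ1_ball dJ1_refl dJ1_sym dJ1_triangle dev_norm_id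
  (fun=> sup_norm_ge0 _) dev_norm_comp).
Qed.

End skoDD_metric.

HB.instance Definition _ (R : realType) := gen_eqMixin (skoDD R).
HB.instance Definition _ (R : realType) := gen_choiceMixin (skoDD R).
HB.instance Definition _ (R : realType) :=
  isPointed.Build (skoDD R) (cst_cadlag (cst_cadlag 0 : skoD R)).
HB.instance Definition _ (R : realType) := isMetric.Build R (skoDD R)
  (@dDD_refl R) (@dDD_eq R) (@dDD_sym R) (@dDD_triangle R).

Section moduli.
Context {R : realType}.

(* t encodes the set 0 = t 0 < t 1 < ... < t v = 1. *)
Definition sparse (delta : R) (v : nat) (t : nat -> R) : Prop :=
  [/\ t 0%N = 0, t v = 1,
      forall i, (i < v)%N -> t i < t i.+1 &
      forall i, (i < v)%N -> delta < t i.+1 - t i].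

Definition oscillation (S : Type) (d : S -> S -> R) (x : I01 R -> S) (a b : R) :
    \bar R :=
  ereal_sup [set (d (x p.1) (x p.2))%:E
            | p in [set p : I01 R * I01 R | a <= ival p.1 < b /\
                                            a <= ival p.2 < b]].

Definition modulus (S : Type) (d : S -> S -> R) (x : I01 R -> S) (delta : R) :
    \bar R :=
  ereal_inf [set \big[maxe/-oo%E]_(i < vt.1)
                   oscillation d x (vt.2 i) (vt.2 i.+1)
            | vt in [set vt : nat * (nat -> R) | sparse delta vt.1 vt.2]].

Definition w' (x : skoD R) (delta : R) : \bar R :=
  modulus (fun a b : R => `|a - b|) x delta.

Definition w'D (x : skoDD R) (delta : R) : \bar R := modulus (@dJ1 R) x delta.

End moduli.

Notation borel T := (g_sigma_algebraType (@open T)).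

Definition tight (R : realType) (I : Type)
    (P : I -> probability (borel (skoDD R)) R) : Prop :=
  forall eta : R, 0 < eta -> exists K : set (skoDD R),
    compact K /\ forall i, ((1 - eta)%:E <= P i K)%E.

(* P^*(A), the infimum of P(B) over the Borel sets B containing A.  It is P(A)
   when A is P-measurable; it is used for the event of condition (ii), which is
   an uncountable union over t and hence need not be Borel (it is analytic). *)
Definition outer_prob (R : realType) (P : probability (borel (skoDD R)) R) :
    set (skoDD R) -> \bar R := mu_ext P.

(* Main.v *)
Require Import Defs.
From mathcomp Require Import all_boot all_order all_algebra.
From mathcomp Require Import all_classical all_reals all_analysis.
From mathcomp Require Import lra.

(** Tightness amounts to relative compactness of sets of large probability, so
    the theorem rests on a compactness criterion and on what can be said about
    the measurability of the events in the conditions.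

    Compactness.  A set of cadlag paths with values in a compact set, whose
    moduli tend to 0 uniformly, is relatively compact for the Skorohod topology,
    already in its logarithmic form ([ultra_path_limit]).  The proof follows an
    ultrafilter.  The points of the partitions converge along it, and so do the
    values of the paths at each time; the limit path is the right-hand limit of
    the pointwise limit.  Time changes that carry the limiting partition points
    to those of a nearby path are the identity plus a small Lipschitz correction
    ([interpolating_time_change]), which makes their logarithmic norm small at
    once.  The criterion is applied twice: with real values, where it describes
    the relatively compact subsets of D ([skoD_compact]), and with values in
    such a subset ([skoDD_compact]).

    From the conditions to tightness.  Condition (iii) together with (i') bounds
    the whole path: each interval of a good partition contains a point of a
    finite grid of times in T ([bounded_of_grid]).  Combined with (ii) this puts
    all values of the path in one compact subset of D, outside events of small
    probability, and (iii) provides the equicontinuity.  The conditions concern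
    large n only, but each single probability satisfies them too, so that the
    limits superior may be replaced by suprema ([limsup_cvg0P]).  For (i') and
    (iii) this is continuity from above on Borel events.  The event of (ii) need
    not be Borel; it is enclosed in the open event that some value of the path
    leaves a given closed set ([w'_event_small]).

    From tightness to the conditions.  Near any path, the norms of the values,
    their moduli, and the modulus of the path are controlled uniformly; a
    compact set is therefore disjoint from all the events of the conditions
    whose parameter is far enough ([uniform_of_tight]). *)

Set Implicit Arguments.
Unset Strict Implicit.
Unset Printing Implicit Defensive.

Import Order.TTheory GRing.Theory Num.Theory.
Import numFieldNormedType.Exports.

Local Open Scope classical_set_scope.
Local Open Scope ring_scope.

(** * Sparse partitions and interpolating time changes *)

Section sparse_partitions.
Context {R : realType}.
Implicit Types (del : R) (v i j : nat) (t : nat -> R).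

Lemma sparse_le del v t i j : sparse del v t -> (i <= j <= v)%N -> t i <= t j.
Proof.
move=> [_ _ tlt _] /andP[ij]; elim: j ij => [|j IH].
  by rewrite leqn0 => /eqP ->.
rewrite leq_eqVlt => /orP[/eqP -> //|]; rewrite ltnS => ij jv.
by apply: le_trans (IH ij (ltnW jv)) _; exact/ltW/tlt.
Qed.

Lemma sparse_gap del v t i j : sparse del v t -> (i < j <= v)%N ->
  del < t j - t i.
Proof.
move=> S /andP[ij jv]; have [_ _ _ gap] := S.
have := gap i (leq_trans ij jv).
have := @sparse_le _ _ _ i.+1 j S; rewrite ij jv => /(_ isT); lra.
Qed.

Lemma sparse_in01 del v t i : sparse del v t -> (i <= v)%N -> 0 <= t i <= 1.
Proof.
move=> S iv; have [t0 t1 _ _] := S.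
by rewrite -{1}t0 -t1 !(sparse_le S)//= ?iv ?leqnn.
Qed.

Lemma sparse_points del v t : sparse del v t ->
  exists p : nat -> I01 R, forall i, (i <= v)%N -> ival (p i) = t i.
Proof.
move=> S; have /choice[p pt] : forall i, exists p : I01 R, (i <= v)%N -> ival p = t i.
  move=> i; have [iv|_] := leqP i v; last by exists I01_0.
  by exists (mkI01 (sparse_in01 S iv)).
by exists p.
Qed.

Lemma sparse_locate del v t (s : R) : sparse del v t -> 0 <= s < 1 ->
  exists2 i, (i < v)%N & t i <= s < t i.+1.
Proof.
move=> [t0 t1 _ _] /andP[s0 s1].
have : exists n, s < t n by exists v; rewrite t1.
move=> /ex_minnP[[|i]]; first by rewrite t0 ltNge s0.
move=> si min; exists i.
  by rewrite ltnNge; apply/negP => vi; have := min v; rewrite t1 s1 ltnNge vi => /(_ isT).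
by rewrite si andbT leNgt; apply/negP => /min; rewrite ltnn.
Qed.

Lemma sparse_locate_left del v t (s : R) : sparse del v t -> 0 < s <= 1 ->
  exists2 i, (i < v)%N & t i < s <= t i.+1.
Proof.
move=> [t0 t1 _ _] /andP[s0 s1].
have : exists n, s <= t n by exists v; rewrite t1.
move=> /ex_minnP[[|i]]; first by rewrite t0 leNgt s0.
move=> si min; exists i.
  by rewrite ltnNge; apply/negP => vi; have := min v; rewrite t1 s1 ltnNge vi => /(_ isT).
by rewrite si andbT ltNge; apply/negP => /min; rewrite ltnn.
Qed.

Lemma sparse_size del v t : sparse del v t -> v%:R * del <= 1.
Proof.
move=> S; have [t0 t1 _ gap] := S.
suff H i : (i <= v)%N -> i%:R * del <= t i by rewrite -[leRHS]t1 H.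
elim: i => [|i IH] iv; first by rewrite mul0r t0.
by have := IH (ltnW iv); have := gap i iv; rewrite -natr1 mulrDl mul1r; lra.
Qed.

Lemma sparseW del del' v t : del' <= del -> sparse del v t -> sparse del' v t.
Proof.
by move=> dd [t0 t1 tlt gap]; split => // i /gap; exact: le_lt_trans.
Qed.

End sparse_partitions.

Section interpolating_time_change.
Context {R : realType}.

Lemma finite_minimum (h : nat -> R -> R) n : exists g : R -> R, forall s,
  (forall i, (i <= n)%N -> g s <= h i s) /\ exists2 i, (i <= n)%N & g s = h i s.
Proof.
suff H s : exists m : R,
    (forall i, (i <= n)%N -> m <= h i s) /\ exists2 i, (i <= n)%N & m = h i s.
  by have [g gP] := choice H; exists g.
elim: n => [|n [m [mh [i0 i0n m0]]]].
  by exists (h 0%N s); split; [move=> i; rewrite leqn0 => /eqP ->|exists 0%N].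
exists (Num.min m (h n.+1 s)); split.
  move=> i; rewrite leq_eqVlt ge_min => /orP[/eqP ->|]; first by rewrite lexx orbT.
  by rewrite ltnS => /mh ->.
have [_|_] := leP m (h n.+1 s); last by exists n.+1.
by exists i0 => //; exact: leqW.
Qed.

(** McShane's formula: the least of the cones of slope [kappa] over the data is
    [kappa]-Lipschitz and interpolates them. *)
Lemma lipschitz_interpolation (kappa : R) v (tau c : nat -> R) : 0 < kappa ->
  (forall i j, (i <= v)%N -> (j <= v)%N -> c i - c j <= kappa * `|tau i - tau j|) ->
  exists g : R -> R, (forall s s', g s - g s' <= kappa * `|s - s'|) /\
    forall i, (i <= v)%N -> g (tau i) = c i.
Proof.
move=> k0 lip.
have [g gP] := finite_minimum (fun i s => c i + kappa * `|s - tau i|) v.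
exists g; split => [s s'|i iv].
  have [_ [i iv gs']] := gP s'; have [/(_ i iv) gs _] := gP s.
  rewrite {}gs'; move: gs; cbv beta => gs.
  have : kappa * `|s - tau i| <= kappa * (`|s - s'| + `|s' - tau i|).
    by rewrite ler_pM2l// ler_distD.
  rewrite mulrDr; lra.
have [/(_ i iv) gi [j jv gj]] := gP (tau i).
move: gi; rewrite {}gj subrr normr0 mulr0 addr0.
by have := lip i j iv jv; lra.
Qed.

Lemma normr_ln_le (r kappa : R) : kappa <= 1 / 2 -> `|r - 1| <= kappa ->
  `|ln r| <= 2 * kappa.
Proof.
move=> k2; rewrite ler_norml => /andP[r1 r2].
have r0 : 0 < r by lra.
rewrite ler_norml; apply/andP; split; last first.
  have := @le_ln1Dx R (r - 1); rewrite (_ : 1 + (r - 1) = r); last by lra.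
  by move=> /(_ ltac:(lra)); lra.
have := @le_ln1Dx R (r^-1 - 1); rewrite (_ : 1 + (r^-1 - 1) = r^-1); last by lra.
rewrite lnV ?posrE//.
have rV : r * r^-1 = 1 by rewrite divff// gt_eqF.
have rV0 : 0 < r^-1 by rewrite invr_gt0.
move=> /(_ ltac:(lra)).
by nra.
Qed.

(** The time change is the identity plus a [kappa]-Lipschitz correction, which
    keeps every difference quotient within [kappa] of 1. *)
Lemma interpolating_time_change (kappa del : R) v (tau t : nat -> R) :
  0 < kappa <= 1 / 2 -> 0 < del -> sparse del v tau ->
  t 0%N = 0 -> t v = 1 ->
  (forall i, (i <= v)%N -> `|t i - tau i| <= kappa * del / 2) ->
  exists2 lam, Lambda R lam & (log_norm lam <= (2 * kappa)%:E)%E /\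
    forall (s : I01 R) i, (i <= v)%N -> ival s = tau i -> ival (lam s) = t i.
Proof.
move=> /andP[k0 k2] del0 S t0 t1 close; have [tau0 tau1 _ _] := S.
have lip i j : (i < j <= v)%N ->
    `|(t i - tau i) - (t j - tau j)| <= kappa * `|tau i - tau j|.
  move=> /andP[ij jv]; have gap : del < tau j - tau i.
    by apply: (sparse_gap S); rewrite ij.
  have := close i (ltnW (leq_trans ij jv)); have := close j jv.
  rewrite (distrC (tau i)) (_ : `|tau j - tau i| = tau j - tau i); last first.
    by rewrite gtr0_norm; lra.
  by rewrite !ler_norml; nra.
have [|g [glip gtau]] :=
    @lipschitz_interpolation kappa v tau (fun i => t i - tau i) k0.
  move=> i j iv jv; apply: le_trans (ler_norm _) _.
  have [ij|ji|->] := ltngtP i j; last by rewrite !subrr normr0 mulr0.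
    by apply: lip; rewrite ij.
  by rewrite distrC (distrC (tau i)); apply: lip; rewrite ji.
have quot s s' : s < s' ->
    - (kappa * (s' - s)) <= g s' - g s <= kappa * (s' - s).
  move=> ss; have := glip s s'; have := glip s' s.
  rewrite (distrC s s') (_ : `|_| = s' - s); last by rewrite gtr0_norm; lra.
  by lra.
have g0 : g 0 = 0 by rewrite -tau0 gtau// t0 tau0 subrr.
have g1 : g 1 = 0 by rewrite -tau1 gtau// t1 tau1 subrr.
pose f s := s + g s.
have fmono s s' : s < s' -> f s < f s'.
  by move=> ss; have := quot _ _ ss; rewrite /f; nra.
have f01 (s : I01 R) : 0 <= f (ival s) <= 1.
  have f0 : f 0 = 0 by rewrite /f g0 addr0.
  have f1 : f 1 = 1 by rewrite /f g1 addr0.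
  have fmonoW r r' : r <= r' -> f r <= f r'.
    by rewrite le_eqVlt => /orP[/eqP ->//|/fmono/ltW].
  by rewrite -f0 -f1 !fmonoW// ?I01_ge0 ?I01_le1.
pose lam s := mkI01 (f01 s).
have lamE s : ival (lam s) = f (ival s) by [].
have lam_lt (s s' : I01 R) : (ival (lam s) < ival (lam s')) = (ival s < ival s').
  rewrite !lamE; apply/idP/idP; last exact: fmono.
  by apply: contraTT; rewrite -!leNgt le_eqVlt =>
    /orP[/eqP ->//|/fmono/ltW].
have fcont : continuous f.
  move=> s; apply/cvgrPdist_lt => e e0; near=> s'.
  have ss' : `|s - s'| < e / 2.
    by near: s'; apply: cvgr_dist_lt => //; rewrite divr_gt0.
  have := glip s s'; have := glip s' s; rewrite (distrC s') /f.
  have := ler_norm (s - s'); have := lerNnormlW (lexx `|s - s'|).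
  move: ss'; move: (`|s - s'|) => D De D1 D2 G1 G2.
  have D0 : 0 <= D by lra.
  have kD : kappa * D <= D by rewrite ler_piMl//; lra.
  by rewrite ltr_norml; lra.
have onto u : exists s, lam s = u.
  have [|c] := @IVT R f 0 1 (ival u) ler01 (continuous_subspaceT fcont).
    rewrite /f g0 g1 !addr0 (min_l (@ler01 R)) (max_r (@ler01 R)).
    by rewrite I01_ge0 I01_le1.
  rewrite in_itv/= => c01 fc; exists (mkI01 c01).
  by apply/ival_inj; rewrite lamE ival_mk.
exists lam; first split => //.
- by move=> s s' ss; rewrite lam_lt.
- exact: increasing_onto_continuous.
split.
  apply: log_norm_le => s s' ss; rewrite lee_fin; apply: normr_ln_le => //.
  have ss0 : 0 < ival s' - ival s by lra.
  have -> : (ival (lam s') - ival (lam s)) / (ival s' - ival s) - 1 =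
      (g (ival s') - g (ival s)) / (ival s' - ival s).
    rewrite !lamE /f -[X in _ - X](@divff _ (ival s' - ival s)) ?gt_eqF//.
    by rewrite -mulrBl; congr (_ / _); lra.
  rewrite normrM normfV (gtr0_norm ss0) ler_pdivrMr// ler_norml.
  exact: quot.
by move=> s i iv si; rewrite lamE /f si gtau// addrC subrK.
Unshelve. all: by end_near.
Qed.

End interpolating_time_change.

(** * Partitions of cadlag paths *)

(** The modulus without its infimum, which need not be attained: it is below [e]
    exactly when the path is partitioned for some [e' < e]. *)
Definition partitioned (R : realType) (S : Type) (d : S -> S -> R)
    (x : I01 R -> S) (del e : R) :=
  exists v t, sparse del v t /\
    forall i p q, (i < v)%N -> t i <= ival p < t i.+1 ->
      t i <= ival q < t i.+1 -> d (x p) (x q) <= e.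

Section partitions_of_paths.
Context {R : realType} {S : pseudoMetricType R}.
Variable d : S -> S -> R.
Hypothesis ballE : forall x e y, ball x e y <-> d x y < e.
Hypothesis dC : forall x y, d x y = d y x.
Hypothesis dT : forall y x z, d x z <= d x y + d y z.

Implicit Types (del e : R) (x y : I01 R -> S).

Lemma modulus_ltP x del e :
  (modulus d x del < e%:E)%E <-> exists2 e', e' < e & partitioned d x del e'.
Proof.
split=> [/ereal_inf_lt[_ [[v t] /= vt <-]] lte|[e' e'e [v [t [vt H]]]]].
  pose m := (\big[maxe/-oo]_(i < v) oscillation d x (t i) (t i.+1))%E.
  have [e' [e'e me']] : exists e', e' < e /\ (m <= e'%:E)%E.
    move: lte; rewrite -/m; case: m => [r|//|]; last first.
      by exists (e - 1); rewrite leNye; split => //; lra.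
    by rewrite lte_fin => re; exists r.
  exists e' => //; exists v, t; split => // i p q iv ip iq.
  rewrite -lee_fin; apply: le_trans me'.
  apply: le_trans (@le_bigmax _ _ _ -oo%E
    (fun i : 'I_v => oscillation d x (t i) (t i.+1)) (Ordinal iv)).
  by apply: ereal_sup_ubound; exists (p, q).
apply: (@le_lt_trans _ _ e'%:E); last by rewrite lte_fin.
apply: ge_ereal_inf; exists (\big[maxe/-oo]_(i < v) oscillation d x (t i) (t i.+1))%E.
  by exists (v, t).
apply: bigmax_le; first exact: leNye.
move=> i _; apply: ge_ereal_sup => _ [[p q] /= [ip iq] <-].
by rewrite lee_fin; exact: H ip iq.
Qed.

Lemma partitionedW x del e del' e' : del' <= del -> e <= e' ->
  partitioned d x del e -> partitioned d x del' e'.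
Proof.
move=> dd ee [v [t [vt H]]]; exists v, t; split; first exact: sparseW vt.
by move=> i p q iv ip iq; apply: le_trans ee; exact: H ip iq.
Qed.

(** A time change carries the partition points of [x] to those of [y].  This is
    what makes both moduli semicontinuous. *)
Lemma partitioned_time_change x y lam r del del' e : Lambda R lam ->
  0 <= del' ->
  (forall s, d (x s) (y (lam s)) <= r) ->
  (forall p q : I01 R, del < ival q - ival p ->
    del' < ival (lam q) - ival (lam p)) ->
  partitioned d x del e -> partitioned d y del' (e + 2 * r).
Proof.
move=> L del'0 xy len [v [t [vt H]]]; have [t0 t1 _ gap] := vt.
have [p pt] := sparse_points vt.
have p0 : p 0%N = I01_0 by apply/ival_inj; rewrite pt.
have p1 : p v = I01_1 by apply/ival_inj; rewrite pt.
exists v, (fun i => ival (lam (p i))); split.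
  have gap' i : (i < v)%N -> del' < ival (lam (p i.+1)) - ival (lam (p i)).
    by move=> iv; apply: len; rewrite !pt ?gap// ltnW.
  split => //; first by rewrite p0 (Lambda0 L).
  - by rewrite p1 (Lambda1 L).
  - by move=> i /gap' h; rewrite -subr_gt0; exact: le_lt_trans h.
have [_ _ onto] := L.
move=> i q q' iv; have [r0 <-] := onto q; have [r1 <-] := onto q'.
rewrite !leNgt !(Lambda_lt L) -!leNgt !pt ?(ltnW iv)// => ir0 ir1.
have := H i r0 r1 iv ir0 ir1; have := xy r0; have := xy r1.
have := dT (x r0) (y (lam r0)) (y (lam r1)).
have := dT (x r1) (x r0) (y (lam r1)).
by rewrite (dC (y (lam r0)) (x r0)); lra.
Qed.

(** The supremum of the [c] such that the times before [c] can be partitioned is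
    attained, because of the left limit at [c], and it is 1, because otherwise
    right-continuity at [c] would extend the partition. *)
Lemma cadlag_partitioned (x : cadlag R S) e : 0 < e ->
  exists2 del, 0 < del & partitioned d x del e.
Proof.
move=> e0.
pose good c := exists v t del, [/\ 0 < del, t 0%N = 0, t v = c,
  forall i, (i < v)%N -> del < t i.+1 - t i &
  forall i p q, (i < v)%N -> t i <= ival p < t i.+1 ->
    t i <= ival q < t i.+1 -> d (x p) (x q) <= e].
have good0 : good 0 by exists 0%N, (fun=> 0), 1.
have extend (b c : R) : good b -> b < c ->
    (forall p q : I01 R, b <= ival p < c -> b <= ival q < c -> d (x p) (x q) <= e) ->
    good c.
  move=> [v [t [del [del0 t0 tv gap osc]]]] bc H.
  pose t' i := if (i <= v)%N then t i else c.
  have t'c : t' v.+1 = c by rewrite /t' ltnn.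
  have t'E i : (i <= v)%N -> t' i = t i by rewrite /t' => ->.
  exists v.+1, t', (Num.min del ((c - b) / 2)); split => //.
  - by rewrite lt_min del0 divr_gt0// subr_gt0.
  - move=> i; rewrite ltnS leq_eqVlt => /orP[/eqP ->|iv].
      by rewrite t'c t'E// gt_min tv; apply/orP; right; lra.
    by rewrite !t'E ?(ltnW iv)// gt_min gap.
  - move=> i p q; rewrite ltnS leq_eqVlt => /orP[/eqP ->|iv].
      by rewrite t'c t'E// tv; exact: H.
    by rewrite !t'E ?(ltnW iv)//; exact: osc.
pose E := [set c | c <= 1 /\ good c].
have E0 : E 0 by split => //; exact: ler01.
have Esup : has_sup E by split; [exists 0|exists 1 => c []].
pose c := sup E.
have c_ub b : E b -> b <= c by exact: (sup_upper_bound Esup).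
have c_adh (h : R) : 0 < h -> exists2 b, E b & c - h < b.
  by move=> h0; have [b] := sup_adherent h0 Esup; exists b.
have c1 : c <= 1 by apply: ge_sup; [exists 0|move=> ? []].
have c0 : 0 <= c by exact: c_ub.
clearbody c.
have c01 : 0 <= c <= 1 by rewrite c0.
have e20 : 0 < e / 2 by rewrite divr_gt0.
have good_c : good c.
  move: c0; rewrite le_eqVlt => /orP[/eqP <- //|c0].
  have [l /(_ _ e20)[h h0 H]] := cadlag_left ballE x (t := mkI01 c01) c0.
  have [b [b1 goodb] cb] := c_adh _ h0.
  have : b <= c by exact: c_ub.
  rewrite le_eqVlt => /orP[/eqP <- //|bc].
  apply: extend goodb bc _ => p q pbc qbc.
  have := H p; have := H q; rewrite ival_mk => Hq Hp.
  have {}Hp : d l (x p) < e / 2 by apply: Hp; lra.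
  have {}Hq : d l (x q) < e / 2 by apply: Hq; lra.
  by have := dT l (x p) (x q); rewrite (dC (x p) l); lra.
have {c0} c_eq1 : c = 1.
  apply/eqP; rewrite eq_le c1 leNgt /=; apply/negP => c_lt1.
  have [h h0 H] := cadlag_right ballE x (t := mkI01 c01) c_lt1 e20.
  pose b := Num.min 1 (c + h).
  have cb : c < b by rewrite lt_min c_lt1 ltrDl.
  suff : E b by move=> /c_ub; rewrite leNgt cb.
  split; first by rewrite ge_min lexx.
  apply: extend good_c cb _ => p q.
  rewrite !lt_min => /and3P[cp _ ph] /and3P[cq _ qh].
  have := H p; have := H q; rewrite ival_mk cp cq ph qh => /(_ isT) Hq /(_ isT) Hp.
  by have := dT (x (mkI01 c01)) (x p) (x q); rewrite (dC (x p) (x (mkI01 c01))); lra.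
have [v [t [del [del0 t0 tv gap osc]]]] := good_c.
exists del => //; exists v, t; split => //; split => //; first by rewrite tv.
by move=> i /gap; lra.
Qed.

End partitions_of_paths.

Section time_change_lengths.
Context {R : realType}.
Implicit Types (lam : I01 R -> I01 R) (p q : I01 R).

(** Any bound on the logarithmic norm would do; [ln 2] gives the factor 2. *)
Lemma log_norm_length lam p q : Lambda R lam ->
  (log_norm lam <= (ln 2)%:E)%E -> ival p < ival q ->
  (ival q - ival p) / 2 <= ival (lam q) - ival (lam p).
Proof.
move=> L le2 pq.
have lpq : ival (lam p) < ival (lam q) by rewrite (Lambda_lt L).
have := le_trans (le_log_norm lam pq) le2; rewrite lee_fin ler_norml => /andP[+ _].
rewrite -lnV ?posrE// ler_ln ?posrE ?invr_gt0 ?divr_gt0 ?subr_gt0//.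
by rewrite ler_pdivlMr ?subr_gt0//; lra.
Qed.

Lemma dev_norm_length lam p q r : (dev_norm lam <= r%:E)%E ->
  ival q - ival p - 2 * r <= ival (lam q) - ival (lam p).
Proof.
move=> le_r.
have H s : `|ival (lam s) - ival s| <= r.
  rewrite -lee_fin; apply: le_trans le_r.
  exact: (le_sup_norm (fun s => ival (lam s) - ival s)).
by have := H p; have := H q; rewrite !ler_norml; lra.
Qed.

End time_change_lengths.

Section skorohod_balls.
Context {R : realType}.

Let absd (a b : R) : R := `|a - b|.

Let dJ1_fin (x y : skoD R) : sko absd log_norm x y \is a fin_num.
Proof.
apply: (@sko_fin R R absd log_norm) => //.
- by move=> a; rewrite /absd subrr normr0.
- by move=> a b; exact: distrC.
- by move=> a b c; exact: ler_distD.
- exact: log_norm_id.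
- exact: log_norm_ge0.
Qed.

Lemma dJ1_lt (x y : skoD R) e : dJ1 x y < e -> exists lam,
  [/\ Lambda R lam, (log_norm lam < e%:E)%E & forall s, `|x s - y (lam s)| < e].
Proof.
move=> xy; apply: (@sko_lt R R absd log_norm).
by rewrite -[X in (X < _)%E]fineK ?lte_fin ?dJ1_fin.
Qed.

Lemma dJ1_le (x y : skoD R) e lam : Lambda R lam -> (log_norm lam <= e%:E)%E ->
  (forall s, `|x s - y (lam s)| <= e) -> dJ1 x y <= e.
Proof.
move=> L le_e H.
suff h : (sko absd log_norm x y <= e%:E)%E.
  by rewrite -lee_fin /dJ1 fineK// dJ1_fin.
exact: sko_le le_e H.
Qed.

Lemma skoD_ballE (x : skoD R) e y : ball x e y <-> dJ1 x y < e.
Proof. by rewrite ballEmdist. Qed.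

Lemma skoDD_ballE (x : skoDD R) e y : ball x e y <-> dDD x y < e.
Proof. by rewrite ballEmdist. Qed.

Let dDD_fin (x y : skoDD R) : sko (@dJ1 R) dev_norm x y \is a fin_num.
Proof.
apply: (sko_fin skoD_ballE dJ1_refl dJ1_sym dJ1_triangle dev_norm_id).
by move=> ?; exact: sup_norm_ge0.
Qed.

Lemma dDD_lt (x y : skoDD R) e : dDD x y < e -> exists lam,
  [/\ Lambda R lam, (dev_norm lam < e%:E)%E & forall s, dJ1 (x s) (y (lam s)) < e].
Proof.
move=> xy; apply: (@sko_lt R (skoD R) (@dJ1 R) dev_norm).
by rewrite -[X in (X < _)%E]fineK ?lte_fin ?dDD_fin.
Qed.

Lemma dDD_le (x y : skoDD R) e lam : Lambda R lam -> (dev_norm lam <= e%:E)%E ->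
  (forall s, dJ1 (x s) (y (lam s)) <= e) -> dDD x y <= e.
Proof.
move=> L le_e H.
suff h : (sko (@dJ1 R) dev_norm x y <= e%:E)%E.
  by rewrite -lee_fin /dDD fineK// dDD_fin.
exact: sko_le le_e H.
Qed.

End skorohod_balls.

(** * Ultrafilters and limits of paths *)

Section ultrafilters.

Lemma ultra_compact_lim (X : Type) (T : topologicalType) (F : set_system X)
    (f : X -> T) (K : set T) : UltraFilter F -> compact K -> F (f @^-1` K) ->
  exists2 p, K p & f x @[x --> F] --> p.
Proof.
move=> FU cK FK; have [p [Kp clp]] := cK (f x @[x --> F]) _ FK.
exists p => // U pU; have [//|FnU] := in_ultra_setVsetC (f @^-1` U) FU.
by have [q []] := clp (~` U) U FnU pU.
Qed.

Lemma ultra_pigeonhole (X : Type) (F : set_system X) (f : X -> nat) n :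
  UltraFilter F -> F [set x | (f x <= n)%N] -> exists k, F [set x | f x = k].
Proof.
move=> FU; elim: n => [|n IH] Fn.
  by exists 0%N; apply: filterS Fn => x /=; rewrite leqn0 => /eqP.
have [|FC] := in_ultra_setVsetC [set x | f x = n.+1] FU; first by exists n.+1.
apply: IH; apply: filterS (filterI Fn FC) => x /= [].
by rewrite leq_eqVlt => /orP[/eqP//|].
Qed.

(** An ultrafilter on the closure of [A] is traced by the open sets on [A]; a
    limit of an ultrafilter on [A] refining that trace is a limit of the given
    one, closed neighbourhoods being enough by regularity. *)
Lemma regular_compact_closure (T : topologicalType) (A : set T) :
  regular_space T ->
  (forall F : set_system T, UltraFilter F -> F A -> exists p : T, F --> p) ->
  compact (closure A).
Proof.
move=> reg H; rewrite compact_ultra => F FU FcA.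
pose G := filter_from [set U : set T | open U /\ F U] (fun U => U `&` A).
have GF : ProperFilter G.
  apply: filter_from_proper; last first.
    move=> U [oU FU']; have [p [cAp Up]] := filter_ex (filterI FcA FU').
    by have [q [Aq Uq]] := cAp U (open_nbhs_nbhs (conj oU Up)); exists q.
  apply: filter_from_filter; first by exists setT; split; [exact: openT|exact: filterT].
  move=> U V [oU FU'] [oV FV]; exists (U `&` V).
    by split; [exact: openI|exact: filterI].
  by move=> x [[]].
have [G' [G'U GG']] := ultraFilterLemma GF.
have G'A : G' A.
  apply: GG'; exists setT => [|x []//].
  by split; [exact: openT|exact: filterT].
have [p G'p] := H G' G'U G'A.
have Fp : F --> p.
  move=> U pU; have [V pV VU] := reg p U pU.
  have [FV|FnV] := in_ultra_setVsetC (closure V) FU; first exact: filterS FV.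
  exfalso.
  have G'n : G' (~` closure V).
    apply: GG'; exists (~` closure V) => [|x []//].
    by split => //; apply: closed_openC; exact: closed_closure.
  have [x [nVx Vx]] := filter_ex (filterI G'n (G'p _ pV)).
  by apply: nVx; exact: subset_closure.
exists p; split => // U pU.
have pU' : F U^° by apply: Fp; exact: nbhs_interior.
have [x [cAx Ux]] := filter_ex (filterI FcA pU').
exact: cAx Ux.
Qed.

End ultrafilters.

Section limits_of_paths.
Context {R : realType} {S : pseudoMetricType R}.
Variable d : S -> S -> R.
Hypothesis ballE : forall x e y, ball x e y <-> d x y < e.
Hypothesis dC : forall x y, d x y = d y x.
Hypothesis dT : forall y x z, d x z <= d x y + d y z.
Implicit Types e del kappa h k : R.

Lemma compact_path_cluster (K : set S) (f : I01 R -> S) (D : set (I01 R)) s :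
  compact K -> (forall r, K (f r)) ->
  (forall h, 0 < h -> exists2 r, D r & `|ival s - ival r| < h) ->
  exists2 c, K c & forall e h, 0 < e -> 0 < h ->
    exists r, [/\ D r, `|ival s - ival r| < h & d c (f r) < e].
Proof.
move=> cK fK adh.
have PF : ProperFilter (within D (nbhs s)).
  apply: Build_ProperFilter_ex => A; rewrite /within/= => /I01_nbhsP[h h0 H].
  by have [r Dr rh] := adh h h0; exists r; exact: H.
have [c [Kc clc]] := cK (f r @[r --> within D (nbhs s)]) _
  (filterS (fun r _ => fK r) filterT).
exists c => // e h e0 h0.
have near_s : (f r @[r --> within D (nbhs s)])
    (f @` [set r | D r /\ `|ival s - ival r| < h]).
  rewrite /nbhs/= /within/=; apply/I01_nbhsP; exists h => // r sr Dr.
  by exists r.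
have [_ [[r [Dr rh] <-] /ballE]] := clc _ _ near_s (nbhsx_ballx c e e0).
by exists r.
Qed.

(** Small oscillation makes the left-hand values Cauchy; compactness of [K]
    stands in for completeness. *)
Lemma cadlag_of_partitions (K : set S) (y : I01 R -> S) : compact K ->
  (forall s, K (y s)) ->
  (forall e, 0 < e -> exists2 del, 0 < del & partitioned d y del e) ->
  is_cadlag y.
Proof.
move=> cK yK part; split => s.
  move=> s1 A /nbhs_ballP[e e0 eA].
  have e20 : 0 < e / 2 by rewrite divr_gt0.
  have [del del0 [v [t [vt osc]]]] := part _ e20.
  have [|i iv /andP[ts st]] := sparse_locate vt (s := ival s).
    by rewrite I01_ge0.
  rewrite /nbhs/= /within/=; apply/I01_nbhsP; exists (t i.+1 - ival s).
    by rewrite subr_gt0.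
  move=> r; rewrite ltr_norml => /andP[sr _] /= rs; apply/eA/ballE.
  by have := osc i s r iv; rewrite ts st => /(_ isT); lra.
move=> s0.
have [|c _ cP] := compact_path_cluster (D := [set r | ival r < ival s]) (s := s) cK yK.
  move=> h h0; pose r := Num.max 0 (ival s - h / 2).
  have r01 : 0 <= r <= 1.
    rewrite le_max lexx/= ge_max ler01/=.
    by have := I01_le1 s; lra.
  have rs : r < ival s by rewrite gt_max s0/=; lra.
  have rh : ival s - h / 2 <= r by rewrite le_max lexx orbT.
  clearbody r; exists (mkI01 r01) => //=; rewrite ival_mk ltr_norml; lra.
exists c => A /nbhs_ballP[e e0 eA].
have e30 : 0 < e / 3 by rewrite divr_gt0.
have [del del0 [v [t [vt osc]]]] := part (e / 3) e30.
have [|i iv /andP[ts st]] := sparse_locate_left vt (s := ival s).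
  by rewrite s0 I01_le1.
have ts0 : 0 < ival s - t i by rewrite subr_gt0.
rewrite /nbhs/= /within/=; apply/I01_nbhsP; exists (ival s - t i) => //.
have [q [/= qs sq cq]] := cP _ _ e30 ts0.
move=> r; rewrite ltr_norml => /andP[_ sr] /= rs; apply/eA/ballE.
have {}osc : d (y q) (y r) <= e / 3.
  by move: sq; rewrite ltr_norml => /andP[_ sq]; apply: (osc i) => //; lra.
by have := dT (y q) c (y r); lra.
Qed.

End limits_of_paths.

Section relative_compactness.
Context {R : realType} {S : pseudoMetricType R}.
Variable d : S -> S -> R.
Hypothesis ballE : forall x e y, ball x e y <-> d x y < e.
Hypothesis dC : forall x y, d x y = d y x.
Hypothesis dT : forall y x z, d x z <= d x y + d y z.
Implicit Types e del kappa h k : R.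

Variables (F : set_system (cadlag R S)) (K : set S).
Hypothesis FU : UltraFilter F.
Hypothesis cK : compact K.
Hypothesis FK : F [set x : cadlag R S | forall s, K (x s)].
Hypothesis Fpart : forall e, 0 < e -> exists2 del, 0 < del &
  F [set x : cadlag R S | partitioned d x del e].

Implicit Types x : cadlag R S.

Let limiting e v (tau : nat -> R) := forall kappa, 0 < kappa ->
  F [set x | exists t, [/\ t 0%N = 0, t v = 1,
    (forall i, (i <= v)%N -> `|t i - tau i| <= kappa) &
    forall i p q, (i < v)%N -> t i <= ival p < t i.+1 ->
      t i <= ival q < t i.+1 -> d (x p) (x q) <= e]].

(** The partitions of the paths have boundedly many points, since these are
    [del]-separated, so along [F] their number is constant and the points
    themselves converge. *)
Let limit_partition e : 0 < e -> exists del v tau,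
  [/\ 0 < del, sparse del v tau & limiting e v tau].
Proof.
move=> e0; have [del del0 Fdel] := Fpart e0.
have /choice[vt vtP] : forall x, exists vt : nat * (nat -> R),
    partitioned d x del e -> sparse del vt.1 vt.2 /\
    forall i p q, (i < vt.1)%N -> vt.2 i <= ival p < vt.2 i.+1 ->
      vt.2 i <= ival q < vt.2 i.+1 -> d (x p) (x q) <= e.
  move=> x; have [[v [t H]]|nx] := pselect (partitioned d x del e).
    by exists (v, t).
  by exists (0%N, fun=> 0).
have [v Fv] : exists v, F [set x | (vt x).1 = v].
  apply: (@ultra_pigeonhole _ _ _ (Num.bound del^-1)) => //.
  apply: filterS Fdel => x /vtP[/sparse_size vdel _] /=.
  rewrite -(ler_nat R); apply: le_trans (ltW (archi_boundP _)); last first.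
    by rewrite invr_ge0 ltW.
  by rewrite -[leRHS]mul1r ler_pdivlMr.
have FP : F [set x | [/\ sparse del v (vt x).2 &
    forall i p q, (i < v)%N -> (vt x).2 i <= ival p < (vt x).2 i.+1 ->
      (vt x).2 i <= ival q < (vt x).2 i.+1 -> d (x p) (x q) <= e]].
  by apply: filterS (filterI Fv Fdel) => x /= [<- /vtP].
have /choice[tau tauP] : forall i, exists r : R, (i <= v)%N -> (vt x).2 i @[x --> F] --> r.
  move=> i; have [iv|_] := leqP i v; last by exists 0.
  have [|r _ cvr] := @ultra_compact_lim _ R F (fun x => (vt x).2 i)
      `[0, 1]%classic FU (@segment_compact R 0 1); last by exists r.
  apply: filterS FP => x [xP _] /=.
  by rewrite in_itv/=; exact: sparse_in01 xP iv.
have close kappa : 0 < kappa ->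
    F [set x | forall i, (i <= v)%N -> `|(vt x).2 i - tau i| <= kappa].
  move=> k0; have : F [set x | forall i : 'I_v.+1, `|(vt x).2 i - tau i| <= kappa].
    apply: filter_forall => i.
    have /cvgr_dist_le/(_ _ k0) := tauP i (ltn_ord i).
    by apply: filterS => x; rewrite distrC.
  by apply: filterS => x /= H i; rewrite -ltnS => iv; exact: (H (Ordinal iv)).
have exP kappa : 0 < kappa -> exists2 t, sparse del v t &
    forall i, (i <= v)%N -> `|t i - tau i| <= kappa.
  move=> k0; have [x [[xP _] xc]] := filter_ex (filterI FP (close _ k0)).
  by exists (vt x).2.
have tau_gap i : (i < v)%N -> del / 2 < tau i.+1 - tau i.
  move=> iv; have [|t [_ _ _ gap] tc] := exP (del / 4); first by rewrite divr_gt0.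
  have := gap i iv; have := tc i (ltnW iv); have := tc _ iv.
  by rewrite !ler_norml; lra.
exists (del / 2), v, tau; split.
- by rewrite divr_gt0.
- split => //.
  + apply/eqP; rewrite -normr_le0; apply/ler_addgt0Pl => k k0; rewrite addr0.
    have [t [t0 _ _ _] tc] := exP k k0.
    by have := tc 0%N (leq0n _); rewrite t0 sub0r normrN.
  + apply/eqP; rewrite -subr_eq0 -normr_le0; apply/ler_addgt0Pl => k k0.
    have [t [_ t1 _ _] tc] := exP k k0.
    by have := tc v (leqnn _); rewrite t1 distrC addr0.
  + by move=> i /tau_gap; lra.
- move=> kappa k0; apply: filterS (filterI FP (close _ k0)) => x [[xP xosc] xc].
  by have [x0 x1 _ _] := xP; exists (vt x).2.
Qed.

(** The limit path is read off from the pointwise limit [z] along [F], whose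
    oscillation inside each interval of a limiting partition is small, by
    passing to a cluster point of [z] from the right. *)
Theorem ultra_path_limit : exists y : cadlag R S, forall e, 0 < e ->
  F [set x | exists lam, [/\ Lambda R lam, (log_norm lam <= e%:E)%E &
    forall s, d (y s) (x (lam s)) <= e]].
Proof.
have /choice[z zP] : forall s, exists c : S, K c /\ forall e, 0 < e -> F [set x | d c (x s) < e].
  move=> s; have [|c Kc cvc] := @ultra_compact_lim _ S F (fun x => x s) K FU cK.
    by apply: filterS FK => x; exact.
  exists c; split => // e e0.
  have : F [set x | ball c e (x s)] := cvc _ (nbhsx_ballx c e e0).
  by apply: filterS => x /ballE.
(* For [kappa] below the distance from [p] and [q] to the endpoints, both lie in
   the same interval of the partition of the path. *)
have z_osc e v tau i p q : limiting e v tau -> (i < v)%N ->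
    tau i < ival p < tau i.+1 -> tau i < ival q < tau i.+1 ->
    d (z p) (z q) <= e.
  move=> H iv ip iq; apply/ler_addgt0Pl => k k0.
  pose kappa := Num.min (Num.min (ival p - tau i) (tau i.+1 - ival p))
                        (Num.min (ival q - tau i) (tau i.+1 - ival q)) / 2.
  have m0 : 0 < Num.min (Num.min (ival p - tau i) (tau i.+1 - ival p))
                        (Num.min (ival q - tau i) (tau i.+1 - ival q)).
    by rewrite !lt_min; lra.
  have [kp1 kp2 kq1 kq2] : [/\ 2 * kappa <= ival p - tau i,
      2 * kappa <= tau i.+1 - ival p, 2 * kappa <= ival q - tau i &
      2 * kappa <= tau i.+1 - ival q].
    by rewrite /kappa mulrC divfK ?pnatr_eq0//; split;
      rewrite !ge_min lexx ?orbT.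
  have kappa0 : 0 < kappa by rewrite divr_gt0.
  clearbody kappa.
  have k20 : 0 < k / 2 by rewrite divr_gt0.
  have [x [[[t [_ _ tc osc]] xp] xq]] := filter_ex
    (filterI (filterI (H _ kappa0) ((zP p).2 _ k20)) ((zP q).2 _ k20)).
  have := tc i (ltnW iv); have := tc i.+1 iv; rewrite !ler_norml => c1 c2.
  have {}osc : d (x p) (x q) <= e by apply: (osc i) => //; lra.
  have := dT (x p) (z p) (z q); have := dT (x q) (x p) (z q).
  by move: xp xq; rewrite /= (dC (x q) (z q)); lra.
have /choice[y yP] : forall s, exists c, [/\ K c,
    ival s = 1 -> c = z s & ival s < 1 -> forall e h, 0 < e -> 0 < h ->
    exists r, [/\ ival s < ival r, `|ival s - ival r| < h & d c (z r) < e]].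
  move=> s; have [s1|s1] := ltP (ival s) 1; last first.
    by exists (z s); split => //; exact: (zP s).1.
  have [h h0|c Kc cP] := compact_path_cluster
    (D := [set r | ival s < ival r]) (s := s) ballE cK (fun r => (zP r).1).
    pose r := Num.min 1 (ival s + h / 2).
    have r01 : 0 <= r <= 1.
      rewrite ge_min lexx/= le_min ler01/=.
      by have := I01_ge0 s; lra.
    have sr : ival s < r by rewrite lt_min s1/=; lra.
    have rh : r <= ival s + h / 2 by rewrite ge_min lexx orbT.
    clearbody r; exists (mkI01 r01) => //=; rewrite ival_mk ltr_norml; lra.
  exists c; split => // s_eq1.
  by move: s1; rewrite s_eq1 ltxx.
(* The left endpoint is allowed for [y], as only values of [z] to the right of
   [p] enter. *)
have yz_osc e del v tau i p q : sparse del v tau -> limiting e v tau -> (i < v)%N ->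
    tau i <= ival p < tau i.+1 -> tau i < ival q < tau i.+1 ->
    d (y p) (z q) <= e.
  move=> S_tau H iv ip iq; apply/ler_addgt0Pl => k k0.
  have [_ _ yp] := yP p.
  have p_lt1 : ival p < 1 by have := sparse_in01 S_tau iv; lra.
  have h0 : 0 < tau i.+1 - ival p by lra.
  have [r [pr rp yr]] := yp p_lt1 _ _ k0 h0.
  have := @z_osc e v tau i r q H iv _ iq; move: rp; rewrite ltr_norml => rp.
  move=> /(_ ltac:(lra)) rq.
  by have := dT (z r) (y p) (z q); lra.
have midpoint del v tau i : 0 < del -> sparse del v tau -> (i < v)%N ->
    exists m : I01 R, ival m = (tau i + tau i.+1) / 2.
  move=> del0 S_tau iv.
  have m01 : 0 <= (tau i + tau i.+1) / 2 <= 1.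
    by have := sparse_in01 S_tau (ltnW iv); have := sparse_in01 S_tau iv; lra.
  by exists (mkI01 m01).
have y_cadlag : is_cadlag y.
  apply: (cadlag_of_partitions ballE dT cK) => [s|e e0]; first by have [] := yP s.
  have e20 : 0 < e / 2 by rewrite divr_gt0.
  have [del [v [tau [del0 S_tau H]]]] := limit_partition e20.
  exists del => //; exists v, tau; split => // i p q iv ip iq.
  have [m mE] := midpoint _ _ _ _ del0 S_tau iv.
  have im : tau i < ival m < tau i.+1.
    by have [_ _ /(_ i iv) + _] := S_tau; rewrite mE; lra.
  have := yz_osc _ _ _ _ _ p m S_tau H iv ip im; have := yz_osc _ _ _ _ _ q m S_tau H iv iq im.
  by have := dT (z m) (y p) (y q); rewrite (dC (z m)); lra.
exists (Cadlag y_cadlag) => e e0 /=.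
have e30 : 0 < e / 3 by rewrite divr_gt0.
have [del [v [tau [del0 S_tau H]]]] := limit_partition e30.
have /choice[m mE] : forall i, exists m : I01 R, (i < v)%N -> ival m = (tau i + tau i.+1) / 2.
  move=> i; have [iv|_] := ltnP i v; last by exists I01_0.
  by have [m] := midpoint _ _ _ _ del0 S_tau iv; exists m.
(* The time change has logarithmic norm at most [2 * kappa], and
   [kappa * del / 2] is less than half of a gap, so that the midpoint [m i] stays
   in the i-th interval. *)
pose kappa := Num.min (1 / 2) (e / 2).
have [k0 k2 ke] : [/\ 0 < kappa, kappa <= 1 / 2 & kappa <= e / 2].
  by split; rewrite /kappa ?ge_min ?lexx ?orbT// lt_min divr_gt0//= divr_gt0.
clearbody kappa.
have kdel0 : 0 < kappa * del / 2 by rewrite divr_gt0// mulr_gt0.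
have Fm : F [set x | forall i : 'I_v, d (z (m i)) (x (m i)) < e / 3].
  by apply: filter_forall => i; exact: (zP _).2.
apply: filterS (filterI (filterI (H _ kdel0) Fm) ((zP I01_1).2 _ e0)).
move=> x [[[t [t0 t1 tc osc]] xm] x1].
have k02 : 0 < kappa <= 1 / 2 by rewrite k0.
have [lam L [lam_le lamE]] := interpolating_time_change k02 del0 S_tau t0 t1 tc.
exists lam; split => // [|s].
  by apply: le_trans lam_le _; rewrite lee_fin; lra.
have [s1|s1] := ltP (ival s) 1; last first.
  have -> : s = I01_1 by apply/ival_inj; rewrite ival1; have := I01_le1 s; lra.
  have [_ -> // _] := yP I01_1.
  by rewrite (Lambda1 L); exact: ltW.
have [|i iv /andP[ts st]] := sparse_locate S_tau (s := ival s).
  by rewrite I01_ge0.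
have gap : del < tau i.+1 - tau i by have [_ _ _ /(_ i iv)] := S_tau.
have im : tau i < ival (m i) < tau i.+1 by rewrite mE//; lra.
have ys : d (y s) (z (m i)) <= e / 3.
  by apply: (yz_osc _ _ _ _ _ s (m i) S_tau H iv) => //; rewrite ts st.
have xs : d (x (m i)) (x (lam s)) <= e / 3.
  apply: (osc i) => //.
    have := tc i (ltnW iv); have := tc _ iv; rewrite mE// !ler_norml.
    have : kappa * del <= del / 2 by rewrite mulrC ler_pM2l//; lra.
    by lra.
  have e1 := lamE (mkI01 (sparse_in01 S_tau (ltnW iv))) i (ltnW iv) erefl.
  have e2 := lamE (mkI01 (sparse_in01 S_tau iv)) i.+1 iv erefl.
  by rewrite -e1 -e2 (Lambda_lt L) leNgt (Lambda_lt L) -leNgt !ival_mk ts st.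
have := xm (Ordinal iv); rewrite /= => zx.
have := dT (z (m i)) (y s) (x (lam s)); have := dT (x (m i)) (z (m i)) (x (lam s)).
lra.
Qed.

End relative_compactness.

(** * Compact and open sets of paths *)

Section compact_sets.
Context {R : realType}.
Implicit Types e del : R.

Definition absd (a b : R) : R := `|a - b|.

Lemma absd_ballE (a e b : R) : ball a e b <-> absd a b < e. Proof. by []. Qed.

Lemma absdC (a b : R) : absd a b = absd b a. Proof. exact: distrC. Qed.

Lemma absd_triangle (b a c : R) : absd a c <= absd a b + absd b c.
Proof. exact: ler_distD. Qed.

(** Sets of paths, in [K], whose moduli tend to 0 uniformly at the rate encoded
    by [del]. *)
Definition equicadlag (S : pseudoMetricType R) (d : S -> S -> R) (K : set S)
    (del : nat -> R) : set (cadlag R S) :=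
  [set x | (forall s, K (x s)) /\
           forall k, partitioned d x (del k) k.+1%:R^-1].

Lemma invn_lt e : 0 < e -> exists k : nat, k.+1%:R^-1 < e.
Proof.
move=> e0; exists (Num.bound e^-1).
rewrite invf_plt ?posrE//.
apply: (lt_le_trans (archi_boundP _)); first by rewrite invr_ge0 ltW.
by rewrite ler_nat.
Qed.

Lemma equicadlag_small (S : pseudoMetricType R) (d : S -> S -> R) (K : set S)
    (del : nat -> R) (F : set_system (cadlag R S)) : Filter F -> (forall k, 0 < del k) ->
  F (equicadlag d K del) -> forall e, 0 < e -> exists2 h, 0 < h &
    F [set x : cadlag R S | partitioned d x h e].
Proof.
move=> FF del0 FA e e0; have [k ke] := invn_lt e0.
exists (del k) => //; apply: filterS FA => x [_ /(_ k)].
exact/partitionedW/ltW.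
Qed.

(** The real-valued case of the criterion, which the logarithmic norm fits as it
    stands. *)
Lemma skoD_compact (K : set R) (del : nat -> R) : compact K ->
  (forall k, 0 < del k) ->
  compact (closure (equicadlag absd K del : set (skoD R))).
Proof.
move=> cK del0; apply: regular_compact_closure; first exact: uniform_regular.
move=> F FU FA.
have [||y yP] := ultra_path_limit absd_ballE absdC absd_triangle FU cK.
- by apply: filterS FA => x [].
- exact: equicadlag_small FA.
exists (y : skoD R) => A /nbhs_ballP[e e0 eA].
have e20 : 0 < e / 2 by rewrite divr_gt0.
apply: filterS (yP _ e20) => x [lam [L lam_le H]].
apply/eA/skoD_ballE; apply: (@le_lt_trans _ _ (e / 2)); last by rewrite gtr_pMr//; lra.
exact: dJ1_le L lam_le H.
Qed.

(** Time changes of small logarithmic norm are close to the identity, so a limit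
    for the logarithmic norm is one for the uniform norm. *)
Lemma skoDD_compact (K : set (skoD R)) (del : nat -> R) : compact K ->
  (forall k, 0 < del k) ->
  compact (closure (equicadlag (@dJ1 R) K del : set (skoDD R))).
Proof.
move=> cK del0; apply: regular_compact_closure; first exact: uniform_regular.
move=> F FU FA.
have [||y yP] := ultra_path_limit skoD_ballE dJ1_sym dJ1_triangle FU cK.
- by apply: filterS FA => x [].
- exact: equicadlag_small FA.
exists (y : skoDD R) => A /nbhs_ballP[e e0 eA].
have e20 : 0 < e / 2 by rewrite divr_gt0.
have [n n0 nP] := log_norm_small e20.
have m0 : 0 < Num.min (n / 2) (e / 2) by rewrite lt_min divr_gt0.
apply: filterS (yP _ m0) => x [lam [L lam_le H]].
apply/eA/skoDD_ballE; apply: (@le_lt_trans _ _ (e / 2)); last by rewrite gtr_pMr//; lra.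
have lam_n : (log_norm lam < n%:E)%E.
  by apply: le_lt_trans lam_le _; rewrite lte_fin gt_min; apply/orP; left; lra.
apply: (dDD_le L) => [|s].
  by apply: sup_norm_le => s; rewrite lee_fin ltW// nP.
by rewrite (le_trans (H s))// ge_min lexx orbT.
Qed.

End compact_sets.

Section perturbation.
Context {R : realType}.
Implicit Types (e r del : R).

Lemma dev_norm_lt (lam : I01 R -> I01 R) r s : (dev_norm lam < r%:E)%E ->
  `|ival (lam s) - ival s| < r.
Proof.
move=> lam_lt; rewrite -lte_fin; apply: le_lt_trans lam_lt.
exact: (le_sup_norm (fun s => ival (lam s) - ival s)).
Qed.

Lemma ln2_gt0 : 0 < ln 2 :> R.
Proof. by rewrite ln_gt0// ltr1n. Qed.

Lemma skoD_partitioned_near (x y : skoD R) r del e : 0 < del -> r <= ln 2 ->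
  dJ1 x y < r -> partitioned absd x del e ->
  partitioned absd y (del / 2) (e + 2 * r).
Proof.
move=> del0 r2 /dJ1_lt[lam [L lam_lt H]].
apply: (partitioned_time_change absdC absd_triangle L).
- by rewrite divr_ge0// ltW.
- by move=> s; exact: (ltW (H s)).
move=> p q pq; have := @log_norm_length R lam p q L _ _.
have lam_le : (log_norm lam <= (ln 2)%:E)%E.
  by apply/ltW/(lt_le_trans lam_lt); rewrite lee_fin.
by move=> /(_ lam_le); lra.
Qed.

Lemma skoD_sup_near (x y : skoD R) r (c : R) : dJ1 x y < r ->
  (exists u, c < `|x u|) -> exists u, c - r < `|y u|.
Proof.
move=> /dJ1_lt[lam [L _ H]] [u cu]; exists (lam u).
by have := H u; have := lerB_dist (x u) (y (lam u)); lra.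
Qed.

(** The gaps of a partition exceed [del] strictly and there are finitely many of
    them. *)
Lemma partitioned_slack (S : Type) (d : S -> S -> R) (x : I01 R -> S) del e :
  partitioned d x del e -> exists2 del', del < del' & partitioned d x del' e.
Proof.
move=> [v [t [[t0 t1 tlt gap] osc]]].
suff [h h0 hP] : exists2 h, del < h & forall i, (i < v)%N -> h < t i.+1 - t i.
  by exists h => //; exists v, t; split.
elim: v gap {t1 tlt osc} => [|v IH] gap; first by exists (del + 1) => //; rewrite ltrDl.
have [i iv|h h0 hP] := IH; first by apply: gap; exact: ltnW.
have gv := gap v (ltnSn v).
exists (Num.min h ((del + (t v.+1 - t v)) / 2)).
  by rewrite lt_min h0/=; lra.
move=> i; rewrite ltnS leq_eqVlt gt_min => /orP[/eqP ->|/hP -> //].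
by apply/orP; right; lra.
Qed.

Lemma w'D_open del e : 0 <= del ->
  open [set x : skoDD R | (w'D x del < e%:E)%E].
Proof.
move=> del0; rewrite openE => x /modulus_ltP[e' e'e /partitioned_slack[h hdel xh]].
pose r := Num.min ((h - del) / 2) ((e - e') / 3).
have r0 : 0 < r by rewrite lt_min !divr_gt0 ?subr_gt0.
have [r1 r2] : r <= (h - del) / 2 /\ r <= (e - e') / 3.
  by rewrite /r !ge_min !lexx orbT.
clearbody r; apply/nbhs_ballP; exists r => //= y /skoDD_ballE/dDD_lt[lam [L lam_lt H]].
apply/modulus_ltP; exists (e' + 2 * r); first by lra.
apply: (partitioned_time_change dJ1_sym dJ1_triangle L _ _ _ xh) => //.
  by move=> s; exact/ltW.
move=> p q pq; have := dev_norm_length p q (ltW lam_lt); lra.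
Qed.

(** Stability under small time changes holds for open intervals of times and
    for the endpoint 1, which all time changes fix. *)
Lemma skoDD_hit_open (D : set (I01 R)) (U : set (skoD R)) :
  (forall s, D s -> exists2 h : R, 0 < h & forall lam, Lambda R lam ->
    `|ival (lam s) - ival s| < h -> D (lam s)) ->
  open U -> open [set x : skoDD R | exists2 s, D s & U (x s)].
Proof.
move=> Dstable oU; rewrite openE => x [s Ds Uxs].
have [h h0 hP] := Dstable s Ds.
have /nbhs_ballP[e e0 eU] := open_nbhs_nbhs (conj oU Uxs).
apply/nbhs_ballP; exists (Num.min h e); first by rewrite /= lt_min h0.
move=> y /skoDD_ballE/dDD_lt[lam [L]].
move=> lam_lt H; exists (lam s).
  apply: hP => //; apply: lt_le_trans (dev_norm_lt s lam_lt) _.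
  by rewrite ge_min lexx.
apply/eU/skoD_ballE; apply: lt_le_trans (H s) _.
by rewrite ge_min lexx orbT.
Qed.

Lemma skoDD_range_closed (C : set (skoD R)) : closed C ->
  closed [set x : skoDD R | forall s, C (x s)].
Proof.
move=> cC; have -> : [set x : skoDD R | forall s, C (x s)] =
    ~` [set x : skoDD R | exists2 s, [set: I01 R] s & (~` C) (x s)].
  apply/seteqP; split => x /=; first by move=> H [s _]; apply.
  by move=> H s; apply: contrapT => nC; apply: H; exists s.
apply: open_closedC; apply: skoDD_hit_open; last exact: closed_openC.
by move=> s _; exists 1.
Qed.

Lemma skoD_exceed_open (c : R) : open [set y : skoD R | exists u, c < `|y u|].
Proof.
rewrite openE => x [u cu]; apply/nbhs_ballP; exists (`|x u| - c) => /=.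
  by rewrite subr_gt0.
move=> y /skoD_ballE/dJ1_lt[lam [L _ H]]; exists (lam u).
by have := H u; have := lerB_dist (x u) (y (lam u)); lra.
Qed.

Lemma skoD_bounded (x : skoD R) : exists M : R, forall u, `|x u| <= M.
Proof.
have [M HM] := cadlag_bounded absd_ballE absd_triangle x.
exists (`|x I01_0| + M) => u.
have := HM u; have := lerB_dist (x u) (x I01_0); rewrite /absd (distrC (x u)); lra.
Qed.

Lemma skoDD_bounded_near (x : skoDD R) : exists M : R, forall y : skoDD R,
  dDD x y < 1 -> forall t u, `|y t u| <= M.
Proof.
have [M HM] := cadlag_bounded skoD_ballE dJ1_triangle x.
have [M0 HM0] := skoD_bounded (x I01_0).
exists (M0 + (M + 1)) => y /dDD_lt[lam [[_ _ onto] _ H]] t u.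
have [s <-] := onto t.
have : dJ1 (x I01_0) (y (lam s)) < M + 1.
  by have := dJ1_triangle (x s) (x I01_0) (y (lam s)); have := H s; have := HM s; lra.
rewrite leNgt => xy; apply/negP => lt_u.
have [w] := @skoD_sup_near (y (lam s)) (x I01_0) (M + 1) (M0 + (M + 1))
  ltac:(by rewrite dJ1_sym) (ex_intro _ u lt_u).
by have := HM0 w; lra.
Qed.

Lemma finitely_partitioned (y : nat -> skoD R) v e : 0 < e ->
  exists2 del, 0 < del & forall i, (i <= v)%N -> partitioned absd (y i) del e.
Proof.
move=> e0; have part z := cadlag_partitioned absd_ballE absdC absd_triangle z e0.
elim: v => [|v [h h0 IH]].
  by have [h h0 H] := part (y 0%N); exists h => // i; rewrite leqn0 => /eqP ->.
have [h' h'0 H] := part (y v.+1).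
exists (Num.min h h'); first by rewrite lt_min h0.
move=> i; rewrite leq_eqVlt => /orP[/eqP ->|].
  by apply: partitionedW H => //; rewrite ge_min lexx orbT.
by rewrite ltnS => /IH; apply: partitionedW => //; rewrite ge_min lexx.
Qed.

(** Up to a small error in [dJ1], a path has finitely many values. *)
Lemma skoDD_values_partitioned (x : skoDD R) e : 0 < e ->
  exists2 del, 0 < del & forall t, partitioned absd (x t) del e.
Proof.
move=> e0; pose r := Num.min (ln 2) (e / 8).
have r0 : 0 < r by rewrite lt_min ln2_gt0 divr_gt0.
have [rln re] : r <= ln 2 /\ r <= e / 8 by rewrite /r !ge_min !lexx orbT.
clearbody r; have r20 : 0 < r / 2 by rewrite divr_gt0.
have [h h0 [v [t [vt osc]]]] :=
  cadlag_partitioned skoD_ballE dJ1_sym dJ1_triangle x r20.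
have [p pt] := sparse_points vt.
have e20 : 0 < e / 2 by rewrite divr_gt0.
have [del del0 H] := finitely_partitioned (fun i => x (p i)) v e20.
exists (del / 2); first by rewrite divr_gt0.
move=> s; have [i iv xs] : exists2 i, (i <= v)%N & dJ1 (x (p i)) (x s) < r.
  have [s1|s1] := ltP (ival s) 1.
    have [|i iv ts] := sparse_locate vt (s := ival s); first by rewrite I01_ge0.
    exists i; first exact: ltnW.
    apply: (@le_lt_trans _ _ (r / 2)); last by lra.
    have [_ _ /(_ i iv) tlt _] := vt.
    by apply: (osc i) => //; rewrite pt ?(ltnW iv)// lexx.
  exists v => //; rewrite (_ : s = p v) ?dJ1_refl//.
  have [_ t1 _ _] := vt; apply/ival_inj; rewrite pt// t1.
  by have := I01_le1 s; lra.
apply: (@partitionedW _ _ _ _ (del / 2) (e / 2 + 2 * r)) => //; first by lra.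
exact: skoD_partitioned_near (H i iv).
Qed.

Lemma skoDD_values_partitioned_near (x : skoDD R) e : 0 < e ->
  exists r del, [/\ 0 < r, 0 < del & forall y : skoDD R, dDD x y < r ->
    forall t, partitioned absd (y t) del e].
Proof.
move=> e0; have e20 : 0 < e / 2 by rewrite divr_gt0.
have [del del0 H] := skoDD_values_partitioned x e20.
exists (Num.min (ln 2) (e / 4)), (del / 2).
split; [by rewrite lt_min ln2_gt0 divr_gt0|by rewrite divr_gt0|].
move=> y /dDD_lt[lam [[_ _ onto] _ xy]] t; have [s <-] := onto t.
have := skoD_partitioned_near del0 _ (xy s) (H s).
rewrite ge_min lexx => /(_ isT); apply: partitionedW => //.
have : Num.min (ln 2) (e / 4) <= e / 4 by rewrite ge_min lexx orbT.
lra.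
Qed.

End perturbation.

(** * Borel events and single probabilities *)

Section borel_events.
Context {R : realType}.
Implicit Types (e r del a : R).

Lemma open_borel (U : set (skoDD R)) : open U ->
  measurable (U : set (borel (skoDD R))).
Proof. exact: sub_sigma_algebra. Qed.

Lemma closed_borel (C : set (skoDD R)) : closed C ->
  measurable (C : set (borel (skoDD R))).
Proof.
move=> cC; rewrite -(setCK C); apply: measurableC; apply: open_borel.
exact: closed_openC.
Qed.

Lemma compact_borel (K : set (skoDD R)) : compact K ->
  measurable (K : set (borel (skoDD R))).
Proof.
by move=> cK; apply: closed_borel; apply: compact_closed => //; exact: metric_hausdorff.
Qed.

Lemma w'D_borel del e : 0 <= del ->
  measurable ([set x : skoDD R | (e%:E <= w'D x del)%E] : set (borel (skoDD R))).
Proof.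
move=> del0; have -> : [set x : skoDD R | (e%:E <= w'D x del)%E] =
    ~` [set x : skoDD R | (w'D x del < e%:E)%E].
  by apply/seteqP; split => x /=; rewrite leNgt => /negP.
by apply: closed_borel; apply: open_closedC; exact: w'D_open.
Qed.

(** Times shortly after [t], to which right-continuity at [t] applies; at the
    endpoint 1, which has no time after it, the window is reduced to 1. *)
Definition right_window (t : I01 R) (h : R) : set (I01 R) :=
  [set s | ival t < ival s < ival t + h \/ s = I01_1 /\ t = I01_1].

Lemma right_window_stable t h s : right_window t h s ->
  exists2 r, 0 < r & forall lam, Lambda R lam ->
    `|ival (lam s) - ival s| < r -> right_window t h (lam s).
Proof.
move=> [/andP[ts sh]|[-> ->]]; last first.
  by exists 1 => // lam L _; right; rewrite (Lambda1 L).
exists (Num.min (ival s - ival t) (ival t + h - ival s)).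
  by rewrite lt_min !subr_gt0 ts.
by move=> lam _; rewrite lt_min !ltr_norml => H; left; lra.
Qed.

Lemma right_window_neq0 t h : 0 < h -> right_window t h !=set0.
Proof.
move=> h0; have [t1|t1] := ltP (ival t) 1; last first.
  exists I01_1; right; split => //; apply/ival_inj; rewrite ival1.
  by have := I01_le1 t; lra.
pose s := Num.min 1 (ival t + h / 2).
have s01 : 0 <= s <= 1.
  rewrite ge_min lexx/= le_min ler01/=.
  by have := I01_ge0 t; lra.
have ts : ival t < s by rewrite lt_min t1/=; lra.
have sh : s <= ival t + h / 2 by rewrite ge_min lexx orbT.
by clearbody s; exists (mkI01 s01); left; rewrite ival_mk ts/=; lra.
Qed.

Lemma right_window_close (x : skoDD R) t e : 0 < e -> exists2 h, 0 < h &
  forall s, right_window t h s -> dJ1 (x t) (x s) < e.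
Proof.
move=> e0; have [t1|t1] := ltP (ival t) 1.
  have [h h0 H] := cadlag_right skoD_ballE x t1 e0.
  exists h => // s [/andP[ts sh]|[-> ->]]; last by rewrite dJ1_refl.
  by apply: H; rewrite sh ltW.
exists 1 => // s [/andP[ts _]|[-> ->]]; last by rewrite dJ1_refl.
by have := I01_le1 s; lra.
Qed.

(** Evaluation at [t] is not continuous, but by right-continuity the event is
    the countable intersection of the open events that the norm exceeds [a - h]
    somewhere in the window of width [h]. *)
Lemma sup_norm_borel (t : I01 R) a :
  measurable ([set x : skoDD R | (a%:E <= sup_norm (x t))%E] : set (borel (skoDD R))).
Proof.
pose U c := [set y : skoD R | exists u, a - c < `|y u|].
have -> : [set x : skoDD R | (a%:E <= sup_norm (x t))%E] =
    \bigcap_k [set x : skoDD R | exists2 s, right_window t k.+1%:R^-1 s & U k.+1%:R^-1 (x s)].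
  apply/seteqP; split => x /=.
    move=> ax k _ /=; have : (0 : R) < k.+1%:R^-1 by rewrite invr_gt0 ltr0n.
    move: (k.+1%:R^-1 : R) => c c0.
    have [u au] : exists u, a - c < `|x t u|.
      have : ((a - c)%:E < sup_norm (x t))%E.
        by apply: lt_le_trans ax; rewrite lte_fin; lra.
      by move=> /ereal_sup_gt[_ [u _ <-]]; rewrite lte_fin; exists u.
    have r0 : 0 < `|x t u| - (a - c) by rewrite subr_gt0.
    have [h h0 H] := right_window_close x t r0.
    have m0 : 0 < Num.min h c by rewrite lt_min h0.
    have [s ws] := right_window_neq0 t m0.
    have [hs cs] : right_window t h s /\ right_window t c s.
      case: ws => [|ws]; last by split; right.
      move=> /andP[ts sm]; split; left; rewrite ts/= (lt_le_trans sm)// lerD2l.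
        by rewrite ge_min lexx.
      by rewrite ge_min lexx orbT.
    exists s => //; have [lam [_ _ /(_ u) xu]] := dJ1_lt (H s hs).
    exists (lam u).
    by have := le_lt_trans (lerB_dist _ _) xu; rewrite ltrD2l ltrN2.
  move=> H; apply/lee_addgt0Pr => e e0.
  have e20 : 0 < e / 2 by rewrite divr_gt0.
  have [h h0 xh] := right_window_close x t e20.
  have [k] : exists k : nat, k.+1%:R^-1 < Num.min h (e / 2).
    by apply: invn_lt; rewrite lt_min h0.
  rewrite lt_min => /andP[kh ke].
  have [s ws [u au]] := H k I.
  have {}ws : right_window t h s.
    case: ws => [/andP[ts sk]|]; [left|by right].
    by rewrite ts (lt_trans sk)// ltrD2l.
  have xs : dJ1 (x s) (x t) < e / 2 by rewrite dJ1_sym; exact: xh.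
  have {}au : a - e / 2 < `|x s u| by apply: le_lt_trans au; rewrite lerD2l lerN2 ltW.
  have [w aw] := skoD_sup_near xs (ex_intro _ u au).
  apply: (@le_trans _ _ (`|x t w| + e)%:E); first by rewrite lee_fin; lra.
  by rewrite EFinD leeD2r// le_sup_norm.
apply: bigcap_measurableType => k _; apply: open_borel.
apply: skoDD_hit_open; last exact: skoD_exceed_open.
by move=> s; exact: right_window_stable.
Qed.

Lemma compact_increasing (T : topologicalType) (K : set T) (Q : nat -> set T) :
  compact K -> (forall x, K x -> exists k, nbhs x (Q k)) ->
  (forall m n, (m <= n)%N -> Q m `<=` Q n) -> exists k, K `<=` Q k.
Proof.
move=> /compact_near_coveringP cov KQ Qmono.
have [|N _ H] := cov nat \oo (fun n x => Q n x) _.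
  move=> x /KQ[k xk]; exists (Q k, [set n | (k <= n)%N]) => /=.
    by split => //; exists k.
  by move=> [y n] /= [Qy kn]; exact: Qmono Qy.
by exists N; apply: H => /=.
Qed.

End borel_events.

Section moduli_monotone.
Context {R : realType}.

Lemma modulus_anti (S : pseudoMetricType R) (d : S -> S -> R) (x : I01 R -> S)
    (del del' e : R) : del' <= del ->
  (modulus d x del < e%:E)%E -> (modulus d x del' < e%:E)%E.
Proof.
move=> dd /modulus_ltP[e' e'e H]; apply/modulus_ltP; exists e' => //.
exact: partitionedW H.
Qed.

Lemma invn_le m n : (m <= n)%N -> n.+1%:R^-1 <= m.+1%:R^-1 :> R.
Proof. by move=> mn; rewrite lef_pV2 ?posrE// ler_nat. Qed.

End moduli_monotone.

Lemma cvge0_lt (R : realType) (T : Type) (F : set_system T) (f : T -> \bar R)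
    (eta : R) : Filter F -> 0 < eta -> f x @[x --> F] --> 0%E ->
  \forall x \near F, (f x < eta%:E)%E.
Proof.
move=> FF eta0 /(_ [set y | (y < eta%:E)%E]); apply.
apply: open_nbhs_nbhs; split; first exact: open_ereal_lt_ereal.
by rewrite /= lte_fin.
Qed.

Section single_probability.
Context {R : realType}.
Variable P : probability (borel (skoDD R)) R.
Implicit Types (e del eta a : R) (A B : set (skoDD R)).

Lemma outer_probE A : measurable (A : set (borel (skoDD R))) ->
  outer_prob P A = P A.
Proof. exact: measurable_mu_extE. Qed.

Lemma outer_prob_le A B : A `<=` B -> (outer_prob P A <= outer_prob P B)%E.
Proof. by move=> AB; exact: (le_mu_ext P AB). Qed.

Lemma outer_prob_bigcup (B : nat -> set (skoDD R)) eta : 0 <= eta ->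
  (forall k, (outer_prob P (B k) <= (eta / (2 ^ k.+1)%:R)%:E)%E) ->
  (outer_prob P (\bigcup_k B k) <= eta%:E)%E.
Proof.
move=> eta0 HB.
apply: le_trans (mu_ext_sigma_subadditive (fun X => measure_ge0 P X) B) _.
apply: le_trans (epsilon_trick0 xpredT eta0).
apply: lee_nneseries => [k _ _|k _]; last exact: HB.
exact: (mu_ext_ge0 (fun X => measure_ge0 P X)).
Qed.

Lemma outer_probU A B (a b : R) : (outer_prob P A <= a%:E)%E ->
  (outer_prob P B <= b%:E)%E -> (outer_prob P (A `|` B) <= (a + b)%:E)%E.
Proof.
move=> Aa Bb; rewrite EFinD.
apply: (@le_trans _ _ (outer_prob P A + outer_prob P B)%E); last exact: leeD.
exact: (outer_measureU2 (mu_ext P)).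
Qed.

Lemma decreasing_events (A : nat -> set (borel (skoDD R))) eta : 0 < eta ->
  (forall k, measurable (A k)) ->
  (forall m n, (m <= n)%N -> A n `<=` A m) -> \bigcap_k A k = set0 ->
  exists k, (P (A k) <= eta%:E)%E.
Proof.
move=> eta0 mA Adecr A0.
have := @nonincreasing_cvg_mu _ _ _ P A _ mA _ _.
rewrite A0 measure0 => /(_ _ _ _)H.
have {}H : (P \o A) x @[x --> \oo] --> 0%E.
  apply: H => //; first by apply: le_lt_trans (probability_le1 P (mA 0%N)) _; exact: ltry.
  by move=> m n mn; apply/subsetPset; exact: Adecr.
have [N _ HN] := cvge0_lt _ eta0 H.
by exists N; apply/ltW/HN => /=.
Qed.

Lemma sup_norm_event_small t eta : 0 < eta ->
  exists a0, (P [set x : skoDD R | (a0%:E <= sup_norm (x t))%E] <= eta%:E)%E.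
Proof.
move=> eta0.
have [k Hk] : exists k, (P [set x : skoDD R | (k%:R%:E <= sup_norm (x t))%E] <= eta%:E)%E.
  apply: decreasing_events => // [k|m n mn x /=|].
  - exact: sup_norm_borel.
  - by apply: le_trans; rewrite lee_fin ler_nat.
  apply/seteqP; split => x //= H.
  have [M HM] := skoD_bounded (x t).
  have M0 : 0 <= M by apply: le_trans (HM I01_0).
  have := H (Num.bound M) I; rewrite /= leNgt => /negP; apply.
  apply: (@le_lt_trans _ _ M%:E); first by apply: sup_norm_le => u; rewrite lee_fin.
  by rewrite lte_fin; exact: archi_boundP.
by exists k%:R.
Qed.

Lemma w'D_event_small e eta : 0 < e -> 0 < eta -> exists2 del, 0 < del &
  (P [set x : skoDD R | (e%:E <= w'D x del)%E] <= eta%:E)%E.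
Proof.
move=> e0 eta0.
have [k Hk] : exists k : nat,
    (P [set x : skoDD R | (e%:E <= w'D x k.+1%:R^-1)%E] <= eta%:E)%E.
  apply: decreasing_events => // [k|m n mn x /=|].
  - by apply: w'D_borel; rewrite invr_ge0.
  - rewrite !leNgt; apply: contra.
    exact/modulus_anti/invn_le.
  apply/seteqP; split => x //= H.
  have e20 : 0 < e / 2 by rewrite divr_gt0.
  have [del del0 xdel] := cadlag_partitioned skoD_ballE dJ1_sym dJ1_triangle x e20.
  have [k kdel] := invn_lt del0.
  have := H k I; rewrite /= leNgt => /negP; apply; apply/modulus_ltP.
  exists (e / 2); first by lra.
  by apply: partitionedW xdel => //; exact: ltW.
by exists k.+1%:R^-1.
Qed.

(** The event of uniform oscillation need not be Borel.  It is enclosed in the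
    open event that the path leaves the closure of the set of functions with a
    good partition, at the cost of a factor on the mesh and on the bound. *)
Lemma w'_event_small e eta : 0 < e -> 0 < eta -> exists2 del, 0 < del &
  (outer_prob P [set x : skoDD R | exists t, (e%:E <= w' (x t) del)%E] <= eta%:E)%E.
Proof.
move=> e0 eta0; have e40 : 0 < e / 4 by rewrite divr_gt0.
pose C k := closure [set y : skoD R | partitioned absd y k.+1%:R^-1 (e / 4)].
have C_closed k : closed [set x : skoDD R | forall t, C k (x t)].
  by apply: skoDD_range_closed; exact: closed_closure.
have mC k : measurable (~` [set x : skoDD R | forall t, C k (x t)] :
    set (borel (skoDD R))).
  by apply: open_borel; exact: closed_openC.
have [k Hk] : exists k, (P (~` [set x : skoDD R | forall t, C k (x t)]) <= eta%:E)%E.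
  apply: decreasing_events => // [m n mn|].
  - apply: subsetC => x /= H t; apply: closure_subset (H t) => y.
    by apply: partitionedW => //; exact: invn_le.
  apply/seteqP; split => x //= H.
  have [del del0 xdel] := skoDD_values_partitioned x e40.
  have [k kdel] := invn_lt del0.
  apply: (H k I) => t; apply: subset_closure.
  by apply: partitionedW (xdel t) => //; exact: ltW.
have k0 : (0 : R) < k.+1%:R^-1 by rewrite invr_gt0.
exists (k.+1%:R^-1 / 2); first by rewrite divr_gt0.
rewrite -(outer_probE (mC k)) in Hk; apply: le_trans Hk; apply: outer_prob_le.
move=> x [t et] Cx; move: et; rewrite leNgt => /negP; apply.
pose r := Num.min (ln 2) (e / 4).
have r0 : 0 < r by rewrite lt_min ln2_gt0.
have [rln re] : r <= ln 2 /\ r <= e / 4 by rewrite /r !ge_min !lexx orbT.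
have [y [yk /skoD_ballE xy]] := Cx t _ (nbhsx_ballx (x t) r r0).
apply/modulus_ltP; exists (e / 4 + 2 * r); first by clearbody r; lra.
by apply: skoD_partitioned_near yk => //; rewrite dJ1_sym.
Qed.

End single_probability.

Section uniform_limsup.
Context {R : realType}.
Variables (F : set_system R) (m : nat -> R -> \bar R).
Hypothesis FF : ProperFilter F.
Implicit Types eta : R.

(** For an antitone family, a [p0] whose limit superior is small serves all large
    [n], and the finitely many remaining [n] are dealt with separately. *)
Lemma limsup_cvg0P (D : set R) : F D -> (forall n p, (0 <= m n p)%E) ->
  (forall p0, D p0 -> \forall p \near F, forall n, (m n p <= m n p0)%E) ->
  (forall n eta, 0 < eta -> exists2 p, D p & (m n p <= eta%:E)%E) ->
  (limn_esup (m ^~ p) @[p --> F] --> 0%E <->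
   forall eta, 0 < eta -> exists2 p, D p & forall n, (m n p <= eta%:E)%E).
Proof.
move=> FD m0 anti small; split => [lim0 eta eta0|H A].
  move: lim0 => /(cvge0_lt _ eta0)/(filterI FD)/filter_ex[p0 [Dp0]].
  move=> /ereal_inf_lt[_ [V [N _ NV] <-] Veta].
  have mN n : (N <= n)%N -> (m n p0 <= eta%:E)%E.
    move=> Nn; apply: le_trans (ltW Veta); apply: ereal_sup_ubound.
    by exists n => //; exact: NV.
  have FN : \forall p \near F, forall n : 'I_N, (m n p <= eta%:E)%E.
    apply: filter_forall => n; have [p Dp mp] := small n eta eta0.
    by apply: filterS (anti p Dp) => q /(_ n) /le_trans; apply.
  have [p [[pN pp0] Dp]] := filter_ex (filterI (filterI FN (anti p0 Dp0)) FD).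
  exists p => // n; have [nN|Nn] := ltnP n N; first exact: (pN (Ordinal nN)).
  exact: le_trans (pp0 n) (mN n Nn).
rewrite {1}/nbhs/= => /nbhs_ballP[eta /= eta0 etaA].
have eta20 : 0 < eta / 2 by rewrite divr_gt0.
have [p0 Dp0 Hp0] := H _ eta20.
apply: filterS (anti p0 Dp0) => p mp /=.
have lim_le : (limn_esup (m ^~ p) <= (eta / 2)%:E)%E.
  apply: ge_ereal_inf; exists (ereal_sup [set m n p | n in [set: nat]]).
    by exists setT => //; exact: filterT.
  by apply: ge_ereal_sup => _ [n _ <-]; apply: le_trans (mp n) (Hp0 n).
have lim_ge : (0 <= limn_esup (m ^~ p))%E.
  by apply: limf_esup_ge0 => // -[N _ /(_ N)]; apply => /=.
move: lim_le lim_ge; case: (limn_esup _) => [r| |]//; rewrite !lee_fin => r1 r0.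
by apply: etaA; rewrite /ball/= sub0r normrN ger0_norm//; lra.
Qed.

End uniform_limsup.

(** * Uniform estimates and tightness *)

Section tightness.
Context {R : realType}.
Variable P : nat -> probability (borel (skoDD R)) R.
Implicit Types (e del eta a h : R).

Lemma dense_grid (T : set (I01 R)) del : dense T -> T I01_1 -> 0 < del ->
  exists N (g : nat -> I01 R), [/\ forall i, (i <= N)%N -> T (g i), g N = I01_1 &
    forall a b : R, 0 <= a -> b <= 1 -> del < b - a ->
      exists2 i, (i <= N)%N & a <= ival (g i) < b].
Proof.
move=> dT T1 del0; have [k kdel] : exists k : nat, k.+1%:R^-1 < del / 2.
  by apply: invn_lt; rewrite divr_gt0.
pose N := k.+1; pose h : R := N%:R^-1.
have h0 : 0 < h by rewrite invr_gt0 ltr0n.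
have Nh : N%:R * h = 1 by rewrite divff// pnatr_eq0.
have hdel : h < del / 2 by [].
have jh j : (j < N)%N -> j%:R * h + h <= 1.
  by move=> jN; rewrite -[leRHS]Nh -[X in _ + X]mul1r -mulrDl natr1 ler_pM2r// ler_nat.
have jh0 j : 0 <= j%:R * h by rewrite mulr_ge0// ltW.
clearbody h.
have /choice[g gP] : forall j, exists s : I01 R, (j < N)%N ->
    T s /\ j%:R * h < ival s < j%:R * h + h.
  move=> j; have [jN|_] := ltnP j N; last by exists I01_1.
  have mid01 : 0 <= j%:R * h + h / 2 <= 1 by have := jh j jN; have := jh0 j; lra.
  have [||s [/= Os Ts]] := dT [set s | j%:R * h < ival s < j%:R * h + h].
  - by exists (mkI01 mid01); rewrite /= ival_mk; lra.
  - rewrite openE => s /= js; apply/I01_nbhsP.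
    exists (Num.min (ival s - j%:R * h) (j%:R * h + h - ival s)).
      by rewrite lt_min !subr_gt0.
    by move=> r; rewrite lt_min !ltr_norml => H; apply/andP; lra.
  - by exists s.
exists N, (fun i => if (i < N)%N then g i else I01_1); split.
- by move=> i _; case: ifP => [/gP[]|].
- by rewrite ltnn.
move=> a b a0 b1 ab.
have : exists j, a <= j%:R * h by exists N; rewrite Nh; lra.
move=> /ex_minnP[j aj jmin].
have ja : j%:R * h <= a + h.
  case: j aj jmin => [|j] _ jmin; first by rewrite mul0r; lra.
  rewrite -natr1 mulrDl mul1r lerD2r leNgt; apply/negP => /ltW /jmin.
  by rewrite ltnn.
have jN : (j < N)%N.
  rewrite -(ltr_nat R) -(ltr_pM2r h0) Nh; lra.
exists j; first exact: ltnW.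
by rewrite jN; have [_] := gP j jN; lra.
Qed.

(** A path with a good partition is controlled by its values on a grid meeting
    each of the intervals of the partition. *)
Lemma bounded_of_grid (x : skoDD R) del a N (g : nat -> I01 R) :
  partitioned (@dJ1 R) x del 1 -> g N = I01_1 ->
  (forall b c : R, 0 <= b -> c <= 1 -> del < c - b ->
      exists2 i, (i <= N)%N & b <= ival (g i) < c) ->
  (forall i, (i <= N)%N -> (sup_norm (x (g i)) < a%:E)%E) ->
  forall t u, `|x t u| <= a + 2.
Proof.
move=> [v [tau [tauS osc]]] g1 grid xg t u.
(* The bound 1 on the oscillation is relaxed to 2, as time changes realise only
   strict bounds on [dJ1]. *)
have [i iN xit] : exists2 i, (i <= N)%N & dJ1 (x t) (x (g i)) < 2.
  have [t1|t1] := ltP (ival t) 1; last first.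
    exists N => //; rewrite (_ : t = g N) ?dJ1_refl//.
    by apply/ival_inj; rewrite g1 ival1; have := I01_le1 t; lra.
  have [|j jv tj] := sparse_locate tauS (s := ival t); first by rewrite I01_ge0.
  have [_ _ _ /(_ j jv) gap] := tauS.
  have [] := grid (tau j) (tau j.+1) _ _ gap.
  - by have /andP[] := sparse_in01 tauS (ltnW jv).
  - by have /andP[] := sparse_in01 tauS jv.
  - move=> i iN gi; exists i => //; apply: le_lt_trans (osc j _ _ jv tj gi) _.
    by rewrite ltr1n.
rewrite leNgt; apply/negP => au.
have [w] := skoD_sup_near xit (ex_intro _ u au); rewrite addrK => aw.
have := xg i iN; rewrite ltNge => /negP; apply.
by apply: le_trans (le_sup_norm (x (g i)) w); rewrite lee_fin ltW.
Qed.

Lemma finite_sup_norm_event (g : nat -> I01 R) N eta :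
  (forall i e, (i <= N)%N -> 0 < e -> exists a, forall n,
    (P n [set x : skoDD R | (a%:E <= sup_norm (x (g i)))%E] <= e%:E)%E) ->
  0 < eta -> exists a, forall n, (outer_prob (P n) [set x : skoDD R |
    exists2 i, (i <= N)%N & (a%:E <= sup_norm (x (g i)))%E] <= eta%:E)%E.
Proof.
elim: N eta => [|N IH] eta H eta0.
  have [a Ha] := H 0%N eta (leqnn 0) eta0; exists a => n; apply: le_trans (Ha n).
  rewrite -outer_probE; last exact: sup_norm_borel.
  by apply: outer_prob_le => x [i]; rewrite leqn0 => /eqP ->.
have eta20 : 0 < eta / 2 by rewrite divr_gt0.
have [a1 H1] := IH _ (fun i e iN => H i e (leqW iN)) eta20.
have [a2 H2] := H N.+1 _ (leqnn _) eta20.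
exists (Num.max a1 a2) => n; have {}H2 := H2 n.
rewrite -outer_probE in H2; last exact: sup_norm_borel.
rewrite [eta]splitr; apply: le_trans (outer_probU (H1 n) H2).
apply: outer_prob_le => x /= [i iN xi].
have xa a' : a' <= Num.max a1 a2 -> (a'%:E <= sup_norm (x (g i)))%E.
  by move=> h; apply: le_trans xi; rewrite lee_fin.
move: iN; rewrite leq_eqVlt => /orP[/eqP iN|iN].
  by right; rewrite -iN; apply: xa; rewrite le_max lexx orbT.
by left; exists i => //; apply: xa; rewrite le_max lexx.
Qed.

(** The compact set is the closure of the set of paths outside all the
    exceptional events; the latter are weighted geometrically. *)
Lemma tight_of_uniform (T : set (I01 R)) : dense T -> T I01_1 ->
  (forall t e, T t -> 0 < e -> exists a, forall n,
    (P n [set x : skoDD R | (a%:E <= sup_norm (x t))%E] <= e%:E)%E) ->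
  (forall e eta, 0 < e -> 0 < eta -> exists2 del, 0 < del & forall n,
    (outer_prob (P n) [set x : skoDD R | exists t, (e%:E <= w' (x t) del)%E]
      <= eta%:E)%E) ->
  (forall e eta, 0 < e -> 0 < eta -> exists2 del, 0 < del & forall n,
    (P n [set x : skoDD R | (e%:E <= w'D x del)%E] <= eta%:E)%E) ->
  tight P.
Proof.
move=> dT T1 Hnorm Hval Hpath eta eta0.
have e0 k : (0 : R) < k.+1%:R^-1 by rewrite invr_gt0 ltr0n.
have eta30 : 0 < eta / 3 by rewrite divr_gt0.
have eta3k k : 0 < eta / 3 / (2 ^ k.+1)%:R by rewrite divr_gt0// ltr0n expn_gt0.
have /choice[dv dvP] : forall k, exists h : R, 0 < h /\ forall n,
    (outer_prob (P n) [set x : skoDD R | exists t,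
      (k.+1%:R^-1%:E <= w' (x t) h)%E] <= (eta / 3 / (2 ^ k.+1)%:R)%:E)%E.
  by move=> k; have [h h0 H] := Hval _ _ (e0 k) (eta3k k); exists h.
have /choice[dp dpP] : forall k, exists h : R, 0 < h /\ forall n,
    (P n [set x : skoDD R | (k.+1%:R^-1%:E <= w'D x h)%E]
      <= (eta / 3 / (2 ^ k.+1)%:R)%:E)%E.
  by move=> k; have [h h0 H] := Hpath _ _ (e0 k) (eta3k k); exists h.
have [N [g [gT g1 grid]]] := dense_grid dT T1 (dpP 0%N).1.
have [a Ha] := finite_sup_norm_event (fun i e iN => Hnorm (g i) e (gT i iN)) eta30.
pose Kv : set (skoD R) := closure
  (equicadlag absd `[- (a + 2), a + 2]%classic dv : set (skoD R)).
have cKv : compact Kv.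
  by apply: skoD_compact => [|k]; [exact: segment_compact|exact: (dvP k).1].
pose K : set (skoDD R) := closure
  (equicadlag (@dJ1 R) Kv dp : set (skoDD R)).
have cK : compact K by apply: skoDD_compact => // k; exact: (dpP k).1.
exists K; split => // n.
pose B0 := [set x : skoDD R | exists2 i, (i <= N)%N & (a%:E <= sup_norm (x (g i)))%E].
pose B1 k := [set x : skoDD R | exists t, (k.+1%:R^-1%:E <= w' (x t) (dv k))%E].
pose B2 k := [set x : skoDD R | (k.+1%:R^-1%:E <= w'D x (dp k))%E].
have KB : ~` K `<=` B0 `|` (\bigcup_k B1 k `|` \bigcup_k B2 k).
  move=> x; apply: contra_notP => xB; apply: subset_closure.
  have xp k : partitioned (@dJ1 R) x (dp k) k.+1%:R^-1.
    have : (w'D x (dp k) < k.+1%:R^-1%:E)%E.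
      by rewrite ltNge; apply/negP => xk; apply: xB; right; right; exists k.
    by move=> /modulus_ltP[e' e'k]; apply: partitionedW => //; exact: ltW.
  split => // t; apply: subset_closure; split => [u|k].
    rewrite /= in_itv/= -ler_norml; apply: bounded_of_grid g1 grid _ t u.
      by have := xp 0%N; rewrite invr1.
    by move=> i iN; rewrite ltNge; apply/negP => xi; apply: xB; left; exists i.
  have : (w' (x t) (dv k) < k.+1%:R^-1%:E)%E.
    by rewrite ltNge; apply/negP => xk; apply: xB; right; left; exists k => //; exists t.
  by move=> /modulus_ltP[e' e'k]; apply: partitionedW => //; exact: ltW.
have mK : measurable (K : set (borel (skoDD R))) by exact: compact_borel.
have PnK : (P n (~` K) <= eta%:E)%E.
  rewrite -outer_probE; last exact: measurableC.
  apply: le_trans (outer_prob_le _ KB) _.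
  have -> : eta = eta / 3 + (eta / 3 + eta / 3) by lra.
  apply: outer_probU; first exact: Ha.
  apply: outer_probU; apply: outer_prob_bigcup; rewrite ?(ltW eta30)// => k.
    exact: (dvP k).2.
  rewrite outer_probE; first exact: (dpP k).2.
  by apply: w'D_borel; exact/ltW/(dpP k).1.
have := probability_setC (P n) (measurableC mK); rewrite setCK => ->.
by rewrite EFinB leeB.
Qed.

(** Along a decreasing sequence of events whose complements eventually contain a
    neighbourhood of each path, a compact set is avoided from some index on. *)
Lemma uniform_of_tight (B : nat -> set (skoDD R)) eta : tight P -> 0 < eta ->
  (forall m n, (m <= n)%N -> B n `<=` B m) ->
  (forall x : skoDD R, exists k, nbhs x (~` B k)) ->
  exists k, forall n, (outer_prob (P n) (B k) <= eta%:E)%E.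
Proof.
move=> tP eta0 Bdecr Bx; have [K [cK PK]] := tP eta eta0.
have [|m n mn|k Kk] := compact_increasing (Q := fun k => ~` B k) cK.
- by move=> x _; exact: Bx.
- exact/subsetC/Bdecr.
have mK := compact_borel cK.
exists k => n; apply: (@le_trans _ _ (outer_prob (P n) (~` K))).
  by apply: outer_prob_le => x Bkx Kx; exact: Kk Bkx.
rewrite outer_probE; last exact: measurableC.
rewrite probability_setC//; have := PK n.
rewrite -(fineK (fin_num_measure (P n) _ mK)) -EFinB !lee_fin; lra.
Qed.

End tightness.

(** * Conditions on limits superior *)

Section limsup_conditions.
Context {R : realType}.
Variable P : nat -> probability (borel (skoDD R)) R.
Implicit Types (e del eta a : R).

Lemma sup_norm_event_anti (t : I01 R) a a' : a' <= a ->
  [set x : skoDD R | (a%:E <= sup_norm (x t))%E] `<=`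
  [set x : skoDD R | (a'%:E <= sup_norm (x t))%E].
Proof. by move=> aa x /=; apply: le_trans; rewrite lee_fin. Qed.

Lemma w'_event_anti e del del' : del' <= del ->
  [set x : skoDD R | exists t, (e%:E <= w' (x t) del')%E] `<=`
  [set x : skoDD R | exists t, (e%:E <= w' (x t) del)%E].
Proof.
move=> dd x /= [t xt]; exists t; move: xt; rewrite !leNgt; apply: contra.
exact: modulus_anti.
Qed.

Lemma w'D_event_anti e del del' : del' <= del ->
  [set x : skoDD R | (e%:E <= w'D x del')%E] `<=`
  [set x : skoDD R | (e%:E <= w'D x del)%E].
Proof.
by move=> dd x /=; rewrite !leNgt; apply: contra; exact: modulus_anti.
Qed.

Lemma limsup_sup_normP (t : I01 R) :
  limn_esup (fun n => P n [set x : skoDD R | (a%:E <= sup_norm (x t))%E])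
    @[a --> +oo] --> 0%E <->
  forall eta, 0 < eta -> exists2 a, True & forall n,
    (P n [set x : skoDD R | (a%:E <= sup_norm (x t))%E] <= eta%:E)%E.
Proof.
apply: (@limsup_cvg0P _ (+oo%R)
  (fun n a => P n [set x : skoDD R | (a%:E <= sup_norm (x t))%E]) _ setT).
- exact: filterT.
- by move=> n a; exact: measure_ge0.
- move=> a _; near=> b => n.
  apply: le_measure; rewrite ?inE; try exact: sup_norm_borel.
  by apply: sup_norm_event_anti; near: b; apply: nbhs_pinfty_ge; rewrite num_real.
- by move=> n eta /(sup_norm_event_small (P n) t)[a Ha]; exists a.
Unshelve. all: by end_near.
Qed.

Lemma limsup_w'P e : 0 < e ->
  limn_esup (fun n => outer_prob (P n)
    [set x : skoDD R | exists t, (e%:E <= w' (x t) del)%E])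
    @[del --> 0^'+] --> 0%E <->
  forall eta, 0 < eta -> exists2 del, 0 < del & forall n,
    (outer_prob (P n) [set x : skoDD R | exists t, (e%:E <= w' (x t) del)%E]
      <= eta%:E)%E.
Proof.
move=> e0; apply: (@limsup_cvg0P _ (0^'+) (fun n del => outer_prob (P n)
  [set x : skoDD R | exists t, (e%:E <= w' (x t) del)%E]) _ [set del | 0 < del]).
- exact: nbhs_right_gt.
- by move=> n del; apply: (mu_ext_ge0 (fun X => measure_ge0 (P n) X)).
- move=> del del0; near=> del' => n; apply: outer_prob_le; apply: w'_event_anti.
  by near: del'; exact: nbhs_right_le.
- by move=> n eta; exact: w'_event_small.
Unshelve. all: by end_near.
Qed.

Lemma limsup_w'DP e : 0 < e ->
  limn_esup (fun n => P n [set x : skoDD R | (e%:E <= w'D x del)%E])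
    @[del --> 0^'+] --> 0%E <->
  forall eta, 0 < eta -> exists2 del, 0 < del & forall n,
    (P n [set x : skoDD R | (e%:E <= w'D x del)%E] <= eta%:E)%E.
Proof.
move=> e0; apply: (@limsup_cvg0P _ (0^'+)
  (fun n del => P n [set x : skoDD R | (e%:E <= w'D x del)%E]) _ [set del | 0 < del]).
- exact: nbhs_right_gt.
- by move=> n del; exact: measure_ge0.
- move=> del /= del0; near=> del' => n.
  apply: le_measure; rewrite ?inE.
  + by apply: w'D_borel; near: del'; exact: nbhs_right_ge.
  + by apply: w'D_borel; exact: ltW.
  + by apply: w'D_event_anti; near: del'; exact: nbhs_right_le.
- by move=> n eta; exact: w'D_event_small.
Unshelve. all: by end_near.
Qed.

Lemma tight_sup_norm (t : I01 R) eta : tight P -> 0 < eta -> exists a, forall n,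
  (P n [set x : skoDD R | (a%:E <= sup_norm (x t))%E] <= eta%:E)%E.
Proof.
move=> tP eta0.
have [||k Hk] := @uniform_of_tight _ P
  (fun k => [set x : skoDD R | (k%:R%:E <= sup_norm (x t))%E]) eta tP eta0.
- by move=> m n mn; apply: sup_norm_event_anti; rewrite ler_nat.
- move=> x; have [M HM] := skoDD_bounded_near x; exists (Num.bound M).
  apply/nbhs_ballP; exists 1 => /= [|y /skoDD_ballE/HM yM]; first exact: ltr01.
  apply/negP; rewrite -ltNge.
  have M0 : 0 <= M by apply: le_trans (yM t I01_0).
  apply: (@le_lt_trans _ _ M%:E); first by apply: sup_norm_le => u; rewrite lee_fin.
  by rewrite lte_fin; exact: archi_boundP.
exists k%:R => n; rewrite -outer_probE//; exact: sup_norm_borel.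
Qed.

Lemma tight_w' e eta : tight P -> 0 < e -> 0 < eta -> exists2 del, 0 < del &
  forall n, (outer_prob (P n)
    [set x : skoDD R | exists t, (e%:E <= w' (x t) del)%E] <= eta%:E)%E.
Proof.
move=> tP e0 eta0; have e20 : 0 < e / 2 by rewrite divr_gt0.
have [||k Hk] := @uniform_of_tight _ P (fun k =>
  [set x : skoDD R | exists t, (e%:E <= w' (x t) k.+1%:R^-1)%E]) eta tP eta0.
- by move=> m n mn; apply: w'_event_anti; exact: invn_le.
- move=> x; have [r [del [r0 del0 H]]] := skoDD_values_partitioned_near x e20.
  have [k kdel] := invn_lt del0; exists k.
  apply/nbhs_ballP; exists r => // y /skoDD_ballE/H yt /= [t].
  rewrite leNgt => /negP; apply; apply/modulus_ltP.
  exists (e / 2); first by lra.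
  by apply: partitionedW (yt t) => //; exact: ltW.
by exists k.+1%:R^-1.
Qed.

Lemma tight_w'D e eta : tight P -> 0 < e -> 0 < eta -> exists2 del, 0 < del &
  forall n, (P n [set x : skoDD R | (e%:E <= w'D x del)%E] <= eta%:E)%E.
Proof.
move=> tP e0 eta0; have e20 : 0 < e / 2 by rewrite divr_gt0.
have [||k Hk] := @uniform_of_tight _ P (fun k =>
  [set x : skoDD R | (e%:E <= w'D x k.+1%:R^-1)%E]) eta tP eta0.
- by move=> m n mn; apply: w'D_event_anti; exact: invn_le.
- move=> x.
  have [del del0 xdel] := cadlag_partitioned skoD_ballE dJ1_sym dJ1_triangle x e20.
  have [k kdel] := invn_lt del0; exists k.
  have k0 : (0 : R) <= k.+1%:R^-1 by rewrite invr_ge0.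
  suff xk : (w'D x k.+1%:R^-1 < e%:E)%E.
    have := open_nbhs_nbhs (conj (@w'D_open R _ e k0) xk).
    by apply: filterS => y /=; rewrite ltNge => /negP.
  apply/modulus_ltP; exists (e / 2); first by lra.
  by apply: partitionedW xdel => //; exact: ltW.
exists k.+1%:R^-1 => // n; rewrite -outer_probE//.
by apply: w'D_borel; rewrite invr_ge0.
Qed.

End limsup_conditions.

Theorem corollary3p7 (R : realType)
    (P : nat -> probability (borel (skoDD R)) R) :
  tight P <->
  [/\ (exists T : set (I01 R), [/\ dense T, T I01_1 &
        forall t, T t ->
          limn_esup (fun n => P n [set x : skoDD R | (a%:E <= sup_norm (x t))%E])
            @[a --> +oo] --> 0%E]),
      (forall eps : R, 0 < eps ->
        limn_esup (fun n => outer_prob (P n)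
            [set x : skoDD R | exists t, (eps%:E <= w' (x t) delta)%E])
          @[delta --> 0^'+] --> 0%E) &
      (forall eps : R, 0 < eps ->
        limn_esup (fun n => P n [set x : skoDD R | (eps%:E <= w'D x delta)%E])
          @[delta --> 0^'+] --> 0%E)].
Proof.
split=> [tP|[[T [dT T1 HT]] Hw' Hw'D]].
  split.
  - exists setT; split => // [U [s Us] _|t _]; first by exists s.
    apply/limsup_sup_normP => eta eta0.
    by have [a Ha] := tight_sup_norm t tP eta0; exists a.
  - by move=> e e0; apply/limsup_w'P => // eta eta0; exact: tight_w'.
  - by move=> e e0; apply/limsup_w'DP => // eta eta0; exact: tight_w'D.
apply: (tight_of_uniform dT T1).
- by move=> t e /HT /limsup_sup_normP H e0; have [a _ Ha] := H e e0; exists a.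
- by move=> e eta e0; move: eta; apply/limsup_w'P => //; exact: Hw'.
- by move=> e eta e0; move: eta; apply/limsup_w'DP => //; exact: Hw'D.
Qed.
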